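(* Let $k\ge1$ and let $\underline T=(T_1,\dots,T_k)$ be an anti-commuting $k$-tuple of contractions on $\mathbb{C}^2$ such that at least one $T_j$ is non-zero and non-invertible. Then $\underline T$ admits a dilation to a $q$-commuting $k$-tuple of unitaries with $q\subseteq\{\pm1\}$.
   Context: A tuple $(T_1,\dots,T_k)$ of operators on a Hilbert space is $q$-commuting, for a family $q=\{q_{ij}\in\mathbb{C}: |q_{ij}|=1,\ q_{ij}=q_{ji}^{-1},\ 1\le i<j\le k\}$, if $T_iT_j=q_{ij}T_jT_i$ for $1\le i<j\le k$; it is anti-commuting if $T_iT_j=-T_jT_i$ for $1\le i<j\le k$. The condition $q\subseteq\{\pm1\}$ means every $q_{ij}\in\{1,-1\}$. A contraction is an operator of norm at most $1$. A tuple of unitaries $(U_1,\dots,U_k)$ on a Hilbert space $\mathcal{K}$ dilates $(T_1,\dots,T_k)$ on $\mathcal{H}$ if there is an isometry $V:\mathcal{H}\to\mathcal{K}$ with $T_1^{m_1}\cdots T_k^{m_k}=V^*U_1^{m_1}\cdots U_k^{m_k}V$ for all non-negative integers $m_1,\dots,m_k$. *)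

(* Defs.v *)
From HB Require Import structures.
From mathcomp Require Import all_boot all_order all_algebra.
From mathcomp Require Import zify.
From mathcomp Require Import sesquilinear spectral complex.
From mathcomp Require Import all_classical all_reals all_analysis.

Set Implicit Arguments.
Unset Strict Implicit.
Unset Printing Implicit Defensive.

Import Order.TTheory GRing.Theory Num.Theory.
Import numFieldNormedType.Exports.

Local Open Scope classical_set_scope.
Local Open Scope ring_scope.

(* The forms [{dot _ for conj}] are linear in the first argument and conjugate
   linear in the second. *)
HB.mixin Record CompleteNormedModule_isHilbert (R : realType) H
    & CompleteNormedModule R[i] H := {
  dotp : {dot H for (@Num.conj R[i])} ;
  dotpE : forall x : H, dotp x x = `|x| ^+ 2
}.

#[short(type="hilbertType")]
HB.structure Definition Hilbert (R : realType) :=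
  {H of CompleteNormedModule R[i] H & CompleteNormedModule_isHilbert R H}.

(* C^n with the Euclidean norm: an alias of ['rV[R[i]]_n], since row vectors
   already carry the sup norm in the library. *)
Definition euclidean (R : realType) (n : nat) : Type := 'rV[R[i]]_n.

HB.instance Definition _ (R : realType) (n : nat) :=
  GRing.Lmodule.copy (euclidean R n) 'rV[R[i]]_n.

Section Euclidean.
Variables (R : realType) (n : nat).
Local Notation E := (euclidean R n).
Local Notation enorm u := (sqrtC (dotmx (u : 'rV[R[i]]_n) u)).
Implicit Types (x y : E).

Fact enormD x y : enorm (x + y) <= enorm x + enorm y.
Proof.
pose d := dotmx (x : 'rV[R[i]]_n) y.
have h0 (u : 'rV[R[i]]_n) : 0 <= enorm u by rewrite sqrtC_ge0 dnorm_ge0.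
rewrite -(ler_pXn2r (ltn0Sn 1)) ?nnegrE ?addr_ge0 ?h0// sqrtCK.
rewrite [X in X <= _](dnormD (@dotmx R[i] n) (x : 'rV[R[i]]_n) y) -/d.
have -> : (enorm x + enorm y) ^+ 2 =
    dotmx (x : 'rV[R[i]]_n) x + dotmx (y : 'rV[R[i]]_n) y +
    2 * (enorm x * enorm y).
  by rewrite sqrrD !sqrtCK -mulr_natl addrAC.
rewrite lerD2l.
have -> : d + d^* = 2 * 'Re d by rewrite ReE mulrC divfK ?pnatr_eq0.
rewrite ler_pM2l ?ltr0n//; apply: le_trans (leif_Re_Creal d).1 _.
exact: (CauchySchwarz_sqrt (@dotmx R[i] n) (x : 'rV[R[i]]_n) y).1.
Qed.

Fact enormZ (a : R[i]) x : enorm (a *: x) = `|a| * enorm x.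
Proof.
rewrite [X in sqrtC X](dnormZ (@dotmx R[i] n) a (x : 'rV[R[i]]_n)).
by rewrite sqrtCM ?nnegrE ?exprn_ge0 ?dnorm_ge0// sqrCK.
Qed.

Fact enorm_eq0 x : enorm x = 0 -> x = 0.
Proof. by move/eqP; rewrite sqrtC_eq0 dnorm_eq0 => /eqP. Qed.

HB.instance Definition _ :=
  Lmodule_isNormed.Build R[i] E enormD enormZ enorm_eq0.

Fact euclidean_normE x : `|x| = enorm x. Proof. by []. Qed.

Fact dotmx_norm x : dotmx (x : 'rV[R[i]]_n) x = `|x| ^+ 2.
Proof. by rewrite euclidean_normE sqrtCK. Qed.

Fact euclidean_norm_sum x : `|x| ^+ 2 = \sum_i `|(x : 'rV_n) 0 i| ^+ 2.
Proof.
rewrite -dotmx_norm dotmxE mxE; apply: eq_bigr => i _.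
by rewrite !mxE normCK.
Qed.

Fact euclidean_coord_le x i : `|(x : 'rV_n) 0 i| <= `|x|.
Proof.
rewrite -(ler_pXn2r (ltn0Sn 1)) ?nnegrE// euclidean_norm_sum (bigD1 i)//=.
by rewrite lerDl sumr_ge0// => j _; rewrite exprn_ge0.
Qed.

Fact euclidean_le_coord x : `|x| <= \sum_i `|(x : 'rV_n) 0 i|.
Proof.
rewrite -(ler_pXn2r (ltn0Sn 1)) ?nnegrE ?sumr_ge0// euclidean_norm_sum.
rewrite expr2 mulr_suml; apply: ler_sum => i _.
rewrite expr2 ler_wpM2l// (bigD1 i)//= lerDl.
exact: sumr_ge0.
Qed.

Let normc_le (z : R[i]) : `|z| <= (`|complex.Re z| + `|complex.Im z|)%:C%C.
Proof.
have normR (r : R) : `|r%:C%C| = `|r|%:C%C.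
  by rewrite normc_def/= expr0n/= addr0 sqrtr_sqr.
have normi : `|'i%C : R[i]| = 1.
  by rewrite normc_def/= expr0n/= add0r expr1n sqrtr1.
rewrite [z in leLHS]complexE (le_trans (ler_normD _ _))// rmorphD/= -!normR.
by rewrite normrM normi mul1r.
Qed.

Let Re_le (z : R[i]) : `|complex.Re z|%:C%C <= `|z|.
Proof.
rewrite normc_def lecR -sqrtr_sqr ler_wsqrtr// lerDl; exact: sqr_ge0.
Qed.

Let Im_le (z : R[i]) : `|complex.Im z|%:C%C <= `|z|.
Proof.
rewrite normc_def lecR -sqrtr_sqr ler_wsqrtr// lerDr; exact: sqr_ge0.
Qed.

Let coord_cvg (F : set_system E) (f : E -> R) : ProperFilter F -> cauchy F ->
  (forall x y, `|f x - f y|%:C%C <= `|x - y|) -> cvg (f @ F).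
Proof.
move=> FF Fc fle; apply/cauchy_cvgP/cauchyP => e e0.
have /cauchyP/(_ e%:C%C) : cauchy F by [].
rewrite ltcR => /(_ e0)[x Fx]; exists (f x).
apply: (@filterS _ F _ (ball x e%:C%C) (f @^-1` ball (f x) e)) Fx => y.
rewrite -!ball_normE/= => xy.
by have := le_lt_trans (fle x y) xy; rewrite ltcR.
Qed.

Fact euclidean_complete (F : set_system E) :
  ProperFilter F -> cauchy F -> cvg F.
Proof.
move=> FF Fc.
pose re i (x : E) := complex.Re ((x : 'rV_n) 0 i).
pose im i (x : E) := complex.Im ((x : 'rV_n) 0 i).
have reF i : cvg (re i @ F).
  apply: coord_cvg => // x y; apply: le_trans (euclidean_coord_le _ i).
  by apply: le_trans (Re_le _); rewrite /re !mxE raddfB.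
have imF i : cvg (im i @ F).
  apply: coord_cvg => // x y; apply: le_trans (euclidean_coord_le _ i).
  by apply: le_trans (Im_le _); rewrite /im !mxE raddfB.
pose l : E := \row_i (lim (re i @ F) +i* lim (im i @ F))%C.
apply/cvg_ex; exists l; apply/cvgrPdist_lt => /= eps eps0.
have [e e0 ->] : exists2 e : R, 0 < e & eps = e%:C%C.
  case: eps eps0 => a b; rewrite ltcE/= => /andP[/eqP b0 a0].
  by exists a; rewrite // b0.
pose d := e / (n.+1 + n.+1)%:R.
have d0 : 0 < d by rewrite divr_gt0// ltr0n.
have near_re : \forall x \near F, forall i, `|lim (re i @ F) - re i x| < d.
  apply: filter_forall => i.
  by have /cvgrPdist_lt/(_ d d0) := reF i.
have near_im : \forall x \near F, forall i, `|lim (im i @ F) - im i x| < d.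
  apply: filter_forall => i.
  by have /cvgrPdist_lt/(_ d d0) := imF i.
apply: filterS2 near_re near_im => x xre xim.
apply: le_lt_trans (euclidean_le_coord _) _.
apply: (@le_lt_trans _ _ (\sum_(i < n) (d + d)%:C%C)).
  apply: ler_sum => i _; apply: le_trans (normc_le _) _.
  by rewrite lecR !mxE !raddfB/= lerD// ltW.
rewrite -rmorph_sum/= ltcR sumr_const card_ord.
have -> : e = d *+ (n.+1 + n.+1) by rewrite -mulr_natr divfK ?pnatr_eq0.
by rewrite -mulr2n -mulrnA ltr_pMn2l//; lia.
Qed.

HB.instance Definition _ := Uniform_isComplete.Build E euclidean_complete.
HB.instance Definition _ :=
  CompleteNormedModule_isHilbert.Build R E dotmx_norm.

End Euclidean.

Section Operators.
Variable R : realType.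
Implicit Types H K : hilbertType R.

Definition contractive H (T : {linear H -> H}) := forall x, `|T x| <= `|x|.

Definition adjoint H K (A : {linear H -> K}) (B : {linear K -> H}) :=
  forall x y, dotp (A x) y = dotp x (B y).

Definition unitary H (U : {linear H -> H}) :=
  exists2 Us : {linear H -> H}, adjoint U Us & cancel U Us /\ cancel Us U.

Definition isometric H K (V : {linear H -> K}) := forall x, `|V x| = `|x|.

Section Tuples.
Variable k : nat.
Implicit Types q : 'I_k -> 'I_k -> R[i].

Definition anti_commuting H (T : 'I_k -> {linear H -> H}) :=
  forall i j : 'I_k, (i < j)%N -> forall x, T i (T j x) = - T j (T i x).

Definition unimodular_family q :=
  forall i j : 'I_k, (i < j)%N -> `|q i j| = 1 /\ q i j = (q j i)^-1.

Definition q_commuting H q (T : 'I_k -> {linear H -> H}) :=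
  unimodular_family q /\
  forall i j : 'I_k, (i < j)%N -> forall x, T i (T j x) = q i j *: T j (T i x).

Definition pm1_valued q :=
  forall i j : 'I_k, (i < j)%N -> q i j = 1 \/ q i j = -1.

(* [monomial T m] is T_0^(m 0) ... T_(k-1)^(m (k-1)), in this order: the
   factor of index k-1 acts first. *)
Definition monomial H (T : 'I_k -> {linear H -> H}) (m : 'I_k -> nat) : H -> H :=
  \big[@comp H H H/idfun]_(i < k) iter (m i) (T i).

Definition dilates H K (U : 'I_k -> {linear K -> K})
    (T : 'I_k -> {linear H -> H}) :=
  exists V : {linear H -> K}, exists Vs : {linear K -> H},
    [/\ isometric V, adjoint V Vs &
        forall m : 'I_k -> nat, monomial T m =1 Vs \o monomial U m \o V].

End Tuples.
End Operators.

(* Main.v *)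
(* Let T_j be singular and nonzero, say T_j x = <x, b> w with b a unit vector.
   Anticommutation with T_j forces one of two shapes.  If w is not orthogonal to
   b, all other T_i are multiples of one rank one operator b' a'^* with
   T_i T_j = T_j T_i = 0.  If w is orthogonal to b, all operators but one are
   multiples of the nilpotent b' b^* and the exceptional one is
   [[p, q], [0, -p]] in the basis (b', b), with |q| <= 1 - |p|^2.

   The dilation lives on l^2(Z; C^2), whose 0-th fibre is C^2.  Let z be the
   bilateral shift.  The unitary S = a b^* + z a' b'^* lifts the partial isometry
   a b^* modulo the sequences supported on positive integers, S' = b' a'^* +
   z b a^* lifts b' a'^*, and S S' = S' S = z.  Scalars t with |t| <= 1 are lifted
   by the unitary Moebius transforms (t + z)(1 + t^* z)^-1, so multiples of a b^*
   and b' a'^* are lifted by commuting unitaries.  In the nilpotent case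
   a = b', a' = b, and the exceptional operator is lifted by phi(S) J, where J
   changes the sign of the b-component of each fibre, so that J S = - S J, and
   phi is a composition of Moebius transforms (a Schur function) with value p and
   prescribed derivative at 0. *)
Require Import Defs.
From HB Require Import structures.
From mathcomp Require Import all_boot all_order all_algebra.
From mathcomp Require Import sesquilinear spectral complex.
From mathcomp Require Import finmap zify ring lra.
From mathcomp Require Import all_classical all_reals all_analysis.
From mathcomp.analysis.showcase Require Import summability.

Set Implicit Arguments.
Unset Strict Implicit.
Unset Printing Implicit Defensive.

Import Order.TTheory GRing.Theory Num.Theory.
Import numFieldNormedType.Exports.

Local Open Scope classical_set_scope.
Local Open Scope ring_scope.

#[local] Existing Instance totally_filter.

(** * Hilbert space preliminaries: polarization, unitaries, Neumann series *)

Section Hilbert.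
Variable R : realType.
Implicit Types H K : hilbertType R.

Definition onto H K (f : H -> K) := forall y, exists x, f x = y.

Lemma dotpC H (x y : H) : dotp x y = (dotp y x)^*.
Proof. by rewrite (hermC (@dotp R H)) mul1r. Qed.

Lemma dotpD2 H (x y : H) :
  `|x + y| ^+ 2 = `|x| ^+ 2 + `|y| ^+ 2 + (dotp x y + (dotp x y)^*).
Proof. by rewrite -!dotpE (hnormD (@dotp R H)) mul1r. Qed.

Lemma pythagoras H (x y : H) :
  dotp x y = 0 -> `|x + y| ^+ 2 = `|x| ^+ 2 + `|y| ^+ 2.
Proof. by move=> xy; rewrite dotpD2 xy conjC0 !addr0. Qed.

Lemma dotpZl H a (x y : H) : dotp (a *: x) y = a * dotp x y.
Proof. exact: (linearZl_LR (@dotp R H)). Qed.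

Lemma dotpZr H a (x y : H) : dotp x (a *: y) = a^* * dotp x y.
Proof. exact: (linearZr_LR (@dotp R H)). Qed.

Lemma dotpDl H (x y z : H) : dotp (x + y) z = dotp x z + dotp y z.
Proof. exact: (linearDl (@dotp R H)). Qed.

Lemma dotpDr H (x y z : H) : dotp x (y + z) = dotp x y + dotp x z.
Proof. exact: (linearDr (@dotp R H)). Qed.

Lemma dotpNl H (x y : H) : dotp (- x) y = - dotp x y.
Proof. exact: (linearNl (@dotp R H)). Qed.

Lemma dotpNr H (x y : H) : dotp x (- y) = - dotp x y.
Proof. exact: (linearNr (@dotp R H)). Qed.

Lemma dotp0l H (x : H) : dotp 0 x = 0.
Proof. exact: (linear0l (@dotp R H)). Qed.

Lemma isometric_dotp H K (V : {linear H -> K}) :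
  isometric V -> forall x y, dotp (V x) (V y) = dotp x y.
Proof.
move=> isoV x y.
have re u v : dotp (V u) (V v) + (dotp (V u) (V v))^* =
    dotp u v + (dotp u v)^*.
  have := isoV (u + v); rewrite linearD => /(congr1 (fun t => t ^+ 2)).
  by rewrite !dotpD2 !isoV => /addrI.
(* The identity [re] compares real parts; replacing [y] by ['i *: y] compares imaginary parts. *)
have := re x ('i *: y); rewrite linearZ/= !dotpZr !rmorphM/= conjCK conjCi.
have -> (z w : R[i]) : - 'i * z + 'i * w = 'i * (w - z) by ring.
have -> (z w : R[i]) : - 'i * z + 'i * w = 'i * (w - z) by ring.
move=> /(mulfI (neq0Ci _)) im.
have /(congr1 (fun z => z / 2)) : 2 * dotp (V x) (V y) = 2 * dotp x y.
  have := congr2 (fun a b => a - b) (re x y) im => /= e.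
  have -> : 2 * dotp (V x) (V y) = dotp (V x) (V y) + (dotp (V x) (V y))^* -
    ((dotp (V x) (V y))^* - dotp (V x) (V y)) by ring.
  by rewrite e; ring.
by rewrite ![2 * _]mulrC !mulfK ?pnatr_eq0.
Qed.

Lemma isometric_inj H K (V : {linear H -> K}) : isometric V -> injective V.
Proof.
move=> isoV x y /eqP; rewrite -subr_eq0 -linearB -normr_eq0 isoV normr_eq0.
by rewrite subr_eq0 => /eqP.
Qed.

Lemma linear_inverse H (U : {linear H -> H}) : injective U ->
  onto U -> exists2 Us : {linear H -> H}, cancel U Us & cancel Us U.
Proof.
move=> injU /choice[g gK].
have glin : linear g by move=> a x y; apply: injU; rewrite gK linearP !gK.
pose Us : {linear H -> H} := HB.pack g (GRing.isLinear.Build _ _ _ _ g glin).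
by exists Us => x; [apply: injU; rewrite gK|rewrite gK].
Qed.

(** By polarization a surjective isometry preserves inner products, so its inverse is its
    adjoint. *)
Lemma isometric_onto_unitary H (U : {linear H -> H}) :
  isometric U -> onto U -> unitary U.
Proof.
move=> isoU surU; have [Us UK UsK] := linear_inverse (isometric_inj isoU) surU.
by exists Us => // x y; rewrite -[in LHS](UsK y) isometric_dotp.
Qed.

Lemma nneg_real (z : R[i]) : 0 <= z -> exists2 r : R, 0 <= r & z = r%:C%C.
Proof.
by case: z => a b; rewrite lecE/= => /andP[/eqP b0 a0]; exists a; rewrite // b0.
Qed.

Lemma norm_expr_small (c C e : R[i]) :
  `|c| < 1 -> 0 <= C -> 0 < e -> exists n, `|c| ^+ n * C < e.
Proof.
have [r r0 ->] := nneg_real (normr_ge0 c).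
move=> r1 /nneg_real[C' C'0 ->] e0.
have [e' e'0 e'E] := nneg_real (ltW e0).
rewrite e'E ltcR in e0 *; rewrite ltcR in r1 *.
have /cvgrPdist_lt/(_ _ e0)[N _ /(_ N (leqnn N))/=] :=
  @cvg_geometric R C' r (etrans (congr1 (fun t => t < 1) (ger0_norm r0)) r1).
rewrite sub0r normrN ger0_norm ?mulr_ge0 ?exprn_ge0// => N_lt.
by exists N; rewrite -rmorphXn -rmorphM ltcR mulrC.
Qed.

(** A solution is a fixed point of [x |-> y - c W x], which shrinks distances by the factor [|c|].
    It serves to solve for the denominator of a Moebius transform. *)
Lemma neumann H (W : {linear H -> H}) (c : R[i]) : isometric W -> `|c| < 1 ->
  forall y, exists x, x + c *: W x = y.
Proof.
move=> isoW c1 y.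
pose step x := y - c *: W x; pose s n := iter n step 0.
have stepB u v : `|step u - step v| = `|c| * `|u - v|.
  rewrite /step [X in `|X|](_ : _ = - (c *: W (u - v))); last first.
    by rewrite (linearB W) scalerBr !opprB addrC addrA subrK.
  by rewrite normrN normrZ isoW.
have c1' : 0 < 1 - `|c| by rewrite subr_gt0.
(* The fixed point of [r |-> |y| + |c| r], hence a bound for all iterates started at 0. *)
pose C : R[i] := `|y| / (1 - `|c|).
have C0 : 0 <= C by rewrite divr_ge0// ltW.
have sC m : `|s m| <= C.
  elim: m => [|m IH]; first by rewrite normr0.
  rewrite /s iterS -/(s m) (le_trans (ler_normB _ _))// normrZ isoW.
  apply: (@le_trans _ _ (`|y| + `|c| * C)).
    by rewrite lerD2l ler_wpM2l.
  by rewrite /C le_eqVlt; apply/orP; left; apply/eqP; field; rewrite gt_eqF.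
have sD n m : `|s n - s (n + m)%N| <= `|c| ^+ n * C.
  elim: n => [|n IH]; first by rewrite mul1r sub0r normrN sC.
  rewrite addSn /s !iterS -/(s n) -/(s (n + m)%N) stepB exprS -mulrA.
  by rewrite ler_wpM2l.
have /cvg_ex[l sl] : cvgn s.
  apply/cauchy_cvgP/cauchy_exP => e e0.
  have [N Ne] := norm_expr_small c1 C0 e0.
  exists (s N); exists N => // n /= Nn.
  rewrite -ball_normE/= -(subnKC Nn); exact: le_lt_trans (sD _ _) Ne.
exists l; apply/eqP; rewrite -subr_eq0 -normr_eq0; apply/eqP.
apply/eqP; rewrite eq_le normr_ge0 andbT; apply/ler_addgt0Pl => e e0.
rewrite addr0.
have e20 : 0 < e / 2 by rewrite divr_gt0.
have /cvgrPdist_lt/(_ _ e20)[N1 _ sl1] := sl.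
have c0 := normr_ge0 c.
have slS : `|l - s N1.+1| < e / 2 by apply: sl1 => /=.
have slN : `|s N1.+1 - step l| < e / 2.
  rewrite [s N1.+1]/(step (s N1)) stepB distrC.
  by apply: le_lt_trans (sl1 N1 (leqnn _)); rewrite ler_piMl// ltW.
rewrite [X in `|X|](_ : _ = (l - s N1.+1) + (s N1.+1 - step l)); last first.
  by rewrite subrKA /step opprB addrA addrAC.
rewrite (le_trans (ler_normD _ _))// (splitr e) ltW// ltrD//.
Qed.

End Hilbert.

(** * Squared norms as real numbers, and the polarization identity *)

Section SquareNorm.
Variables (R : realType) (E : hilbertType R).
Implicit Types u v : E.

(** Norms take values in [R[i]], whereas suprema of partial sums are taken in [R]. *)
Definition nsq u : R := complex.Re (`|u| ^+ 2).

Lemma nsqE u : (nsq u)%:C%C = `|u| ^+ 2.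
Proof.
rewrite /nsq; have [r r0 ->] := nneg_real (normr_ge0 u).
by rewrite -rmorphXn.
Qed.

Lemma nsq_ge0 u : 0 <= nsq u.
Proof. by rewrite -(@lecR R) nsqE exprn_ge0. Qed.

Lemma nsq_parallelogram u v : nsq (u + v) + nsq (u - v) = 2 * nsq u + 2 * nsq v.
Proof.
have inj : injective (fun r : R => r%:C%C) by move=> r s [].
apply: inj; rewrite !rmorphD/= !rmorphM/= !nsqE [in RHS]rmorph_nat.
by rewrite !dotpD2 normrN dotpNr rmorphN; ring.
Qed.

Lemma nsqD u v : nsq (u + v) <= 2 * nsq u + 2 * nsq v.
Proof. by rewrite -nsq_parallelogram lerDl nsq_ge0. Qed.

Lemma nsqZ a u : nsq (a *: u) = complex.Re (`|a| ^+ 2) * nsq u.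
Proof.
rewrite /nsq normrZ exprMn.
have [r r0 ->] := nneg_real (normr_ge0 u).
have [s s0 ->] := nneg_real (normr_ge0 a).
by rewrite -!rmorphXn -rmorphM.
Qed.

Lemma nsq0 : nsq 0 = 0.
Proof. by rewrite /nsq normr0 expr0n. Qed.

Lemma dotp_nsq u v : dotp u v = 4^-1 *
  ((nsq (u + v))%:C%C - (nsq (u - v))%:C%C +
   'i * (nsq (u + 'i *: v))%:C%C - 'i * (nsq (u - 'i *: v))%:C%C).
Proof.
rewrite !nsqE !dotpD2 !normrN !dotpNr !dotpZr.
have -> : ('i : R[i])^* = - 'i by exact: conjCi.
rewrite !rmorphN !rmorphM/= !rmorphN/=.
have -> : ('i : R[i])^* = - 'i by exact: conjCi.
set d := dotp u v; set d' := d^*.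
set s := _ + _.
have -> : s = 4 * d; last by rewrite mulKf// pnatr_eq0.
have i2 : ('i : R[i]) ^+ 2 = -1 by exact: sqrCi.
rewrite /s.
transitivity (2 * d + 2 * d' - 2 * 'i ^+ 2 * d + 2 * 'i ^+ 2 * d').
  by ring.
by rewrite i2; ring.
Qed.

End SquareNorm.

(** * Unordered sums of non-negative reals *)

Section TotalSums.
Variables (R : realType) (I : choiceType).
Local Notation fs := {fset I}.

Lemma ler_big_fset (a : I -> R) (A B : fs) : (forall i, 0 <= a i) ->
  fsubset A B -> \sum_(i <- A) a i <= \sum_(i <- B) a i.
Proof.
move=> a0 AB; rewrite [leRHS](big_fsetID _ (mem A))/=.
have -> : [fset x in B | x \in A]%fset = A.
  by apply/fsetP => x; rewrite !inE/= andb_idl// => /(fsubsetP AB).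
by rewrite lerDl sumr_ge0.
Qed.

(** Monotone convergence along finite subsets: the limit is the supremum. Its two defining bounds
    are kept because norm estimates in [l2] rest on them. *)
Lemma totally_sup_cvg (a : I -> R) (M : R) : (forall i, 0 <= a i) ->
  (forall A : fs, \sum_(i <- A) a i <= M) ->
  exists2 l : R, (fun A : fs => \sum_(i <- A) a i) @ totally --> l &
   (forall A : fs, \sum_(i <- A) a i <= l) /\
   (forall N : R, (forall A : fs, \sum_(i <- A) a i <= N) -> l <= N).
Proof.
move=> a0 aM; pose S := [set \sum_(i <- A) a i | A in [set: fs]].
have supS : has_sup S.
  split; first by exists (\sum_(i <- fset0) a i), fset0.
  by exists M => _ [A _ <-].
have le_sup (A : fs) : \sum_(i <- A) a i <= sup S.
  by apply: sup_upper_bound => //; exists A.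
exists (sup S); last first.
  by split=> // N le_N; apply: ge_sup; [exact: supS.1|move=> _ [A _ <-]].
apply/cvgrPdist_lt => e e0.
have [_ [A _ <-] ltA] := sup_adherent e0 supS.
exists A => // B /= AB; have := ler_big_fset a0 AB.
rewrite ger0_norm ?subr_ge0// => AB'.
by rewrite ltrBlDl -ltrBlDr (lt_le_trans ltA).
Qed.

End TotalSums.

(** * Square-summable families and the inner product space [l2] *)

Section L2.
Variables (R : realType) (I : choiceType) (E : hilbertType R).
Local Notation fs := {fset I}.

Definition square_summable (f : I -> E) :=
  exists M : R, forall A : fs, \sum_(i <- A) nsq (f i) <= M.

Lemma square_summableP a (f g : I -> E) : square_summable f ->
  square_summable g -> square_summable (fun i => a *: f i + g i).
Proof.
move=> [M fM] [N gN]; exists (2 * (complex.Re (`|a| ^+ 2) * M) + 2 * N) => A.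
apply: (@le_trans _ _ (\sum_(i <- A) (2 * nsq (a *: f i) + 2 * nsq (g i)))).
  by apply: ler_sum => i _; exact: nsqD.
rewrite big_split/= -!mulr_sumr lerD ?ler_pM2l//.
under eq_bigr do rewrite nsqZ; rewrite -mulr_sumr ler_wpM2l//.
have [s s0 ->] := nneg_real (normr_ge0 a).
by rewrite -rmorphXn exprn_ge0.
Qed.

Lemma cvg_complex (T : Type) (F : set_system T) (f : T -> R) (l : R) :
  Filter F -> f @ F --> l ->
  (fun t => (f t)%:C%C : R[i]^o) @ F --> (l%:C%C : R[i]^o).
Proof.
move=> FF fl; apply/cvgrPdist_lt => /= e e0.
have [e' e'0 eE] := nneg_real (ltW e0).
rewrite eE ltcR in e0; move/cvgrPdist_lt: fl => /(_ _ e0).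
apply: filterS => t; rewrite eE -rmorphB/= normc_def/= expr0n/= addr0 sqrtr_sqr.
by rewrite ltcR.
Qed.

(** By [dotp_nsq] each term combines four squared norms, whose unordered sums converge because they
    are bounded. *)
Lemma dotp_sum_cvg (f g : I -> E) : square_summable f -> square_summable g ->
  cvg ((fun A : fs => \sum_(i <- A) dotp (f i) (g i) : R[i]^o) @ totally).
Proof.
move=> f2 g2.
have nsq_cvg a : exists l : R,
    (fun A : fs => (\sum_(i <- A) nsq (f i + a *: g i))%:C%C : R[i]^o) @ totally
      --> (l%:C%C : R[i]^o).
  have [M le_M] := square_summableP a g2 f2.
  have [|l ll _] := totally_sup_cvg (fun i => nsq_ge0 (f i + a *: g i)) (M:=M).
    by move=> A; under eq_bigr do rewrite addrC; exact: le_M.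
  by exists l; apply: cvg_complex ll.
have [l1 c1] := nsq_cvg 1; have [l2 c2] := nsq_cvg (-1).
have [l3 c3] := nsq_cvg 'i; have [l4 c4] := nsq_cvg (- 'i).
apply/cvg_ex; exists (4^-1 *: ((l1%:C%C - l2%:C%C : R[i]^o) +
  'i *: (l3%:C%C : R[i]^o) - 'i *: (l4%:C%C : R[i]^o)) : R[i]^o).
rewrite (_ : (fun A => _) = fun A : fs =>
  4^-1 *: (((\sum_(i <- A) nsq (f i + 1 *: g i))%:C%C -
     (\sum_(i <- A) nsq (f i + (-1) *: g i))%:C%C : R[i]^o)
   + 'i *: ((\sum_(i <- A) nsq (f i + 'i *: g i))%:C%C : R[i]^o)
   - 'i *: ((\sum_(i <- A) nsq (f i + (- 'i) *: g i))%:C%C : R[i]^o)));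
  last first.
  have sc (a b : R[i]) : a *: (b : R[i]^o) = a * b by [].
  apply/funext => A; rewrite !rmorph_sum/= !sc.
  rewrite !mulr_sumr -sumrB -big_split/= -sumrB mulr_sumr.
  apply: eq_bigr => i _.
  by rewrite dotp_nsq scale1r scaleN1r scaleNr.
exact: (cvgZl_tmp (cvgB (cvgD (cvgB c1 c2) (cvgZl_tmp c3)) (cvgZl_tmp c4))).
Qed.

End L2.

(** A boolean predicate, so that [l2] inherits its module structure as a submodule of the
    functions. *)
Definition l2pred (R : realType) (I : choiceType) (E : hilbertType R) :
  {pred I -> E} := fun f => `[< square_summable f >].

Record l2 (R : realType) (I : choiceType) (E : hilbertType R) :=
  L2 { l2val :> I -> E; _ : l2val \in @l2pred R I E }.

Section L2space.
Variables (R : realType) (I : choiceType) (E : hilbertType R).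
Local Notation K := (l2 I E).

HB.instance Definition _ := [isSub for @l2val R I E].
HB.instance Definition _ := [Choice of K by <:].

Lemma l2pred_submod_closed : submod_closed (@l2pred R I E).
Proof.
split=> [|a f g].
  apply/asboolP; exists 0 => A; rewrite big1// => i _.
  by rewrite -[X in nsq X]/(0 : E) nsq0.
move=> /asboolP f2 /asboolP g2; apply/asboolP.
exact: (square_summableP a f2 g2).
Qed.

HB.instance Definition _ :=
  GRing.isSubmodClosed.Build R[i] (I -> E) (@l2pred R I E)
  l2pred_submod_closed.
HB.instance Definition _ := [SubChoice_isSubLmodule of K by <:].

Lemma l2P (f : K) : square_summable f.
Proof. exact/asboolP/(valP f). Qed.

Lemma l2_ext (f g : K) : f =1 g -> f = g.
Proof. by move=> fg; apply/val_inj/funext. Qed.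

Lemma l2D (f g : K) i : (f + g) i = f i + g i. Proof. by []. Qed.

Definition l2dot (f g : K) : R[i] :=
  lim ((fun A : {fset I} => \sum_(i <- A) dotp (f i) (g i) : R[i]^o) @ totally).

Lemma l2dot_cvg (f g : K) :
  (fun A : {fset I} => \sum_(i <- A) dotp (f i) (g i) : R[i]^o) @ totally
    --> (l2dot f g : R[i]^o).
Proof. by apply: dotp_sum_cvg; exact: l2P. Qed.

Lemma l2dot_unique (f g : K) (l : R[i]^o) :
  (fun A : {fset I} => \sum_(i <- A) dotp (f i) (g i) : R[i]^o) @ totally
    --> l ->
  l2dot f g = l.
Proof. exact: (cvg_unique (@norm_hausdorff _ _) (@l2dot_cvg f g)). Qed.

Lemma l2dotPl (a : R[i]) (f g h : K) :
  l2dot (a *: f + g) h = a * l2dot f h + l2dot g h.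
Proof.
apply: l2dot_unique.
rewrite (_ : (fun A => _) = fun A : {fset I} =>
    a *: (\sum_(i <- A) dotp (f i) (h i) : R[i]^o) +
    (\sum_(i <- A) dotp (g i) (h i) : R[i]^o)).
  exact: (cvgD (cvgZl_tmp (@l2dot_cvg f h)) (@l2dot_cvg g h)).
apply/funext => A; rewrite scaler_sumr -big_split/=; apply: eq_bigr => i _.
by rewrite -[X in dotp X _]/(a *: f i + g i) dotpDl dotpZl.
Qed.

Lemma l2dotC (f g : K) : l2dot f g = (l2dot g f)^*.
Proof.
apply: l2dot_unique.
apply/cvgrPdist_lt => e e0.
have /cvgrPdist_lt/(_ _ e0) := @l2dot_cvg g f.
apply: filterS => A; congr (_ < _).
rewrite -norm_conjC rmorphB/= rmorph_sum/=; congr (`|_ - _|).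
by apply: eq_bigr => i _; rewrite -dotpC.
Qed.

Lemma l2dot_linearl (g : K) : linear_for *%R (l2dot^~ g).
Proof. by move=> a f h; exact: l2dotPl. Qed.

Lemma l2dot_linearr (f : K) : linear_for ((@Num.conj R[i]) \; *%R) (l2dot f).
Proof.
by move=> a g h; rewrite /= l2dotC l2dotPl rmorphD rmorphM/= -!l2dotC.
Qed.

Lemma l2dot_hermitian (f g : K) :
  l2dot f g = (-1) ^+ false * (l2dot g f)^*.
Proof. by rewrite mul1r l2dotC. Qed.

(** Since the squared norm is a supremum of finite sums, norm bounds can be tested on finite sets of
    indices. *)
Lemma nsq_sum_cvg (f : K) :
  exists2 l : R, l2dot f f = l%:C%C &
    (forall A : {fset I}, \sum_(i <- A) nsq (f i) <= l) /\
    forall M : R, (forall A : {fset I}, \sum_(i <- A) nsq (f i) <= M) -> l <= M.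
Proof.
have [M f2] := l2P f.
have [l fl le_l] := totally_sup_cvg (fun i => nsq_ge0 (f i)) f2.
exists l.
  apply: l2dot_unique.
  rewrite (_ : (fun A => _) =
    fun A : {fset I} => (\sum_(i <- A) nsq (f i))%:C%C : R[i]^o).
    exact: cvg_complex fl.
  apply/funext => A; rewrite rmorph_sum/=; apply: eq_bigr => i _.
  by rewrite nsqE dotpE.
exact: le_l.
Qed.

Lemma l2dot_gt0 (f : K) : f != 0 -> 0 < l2dot f f.
Proof.
move=> f0; have [l -> [le_l _]] := nsq_sum_cvg f.
have /existsNP[i /eqP fi0] : ~ (f =1 (0 : K)) by move=> /l2_ext/eqP; apply/negP.
rewrite ltcR (@lt_le_trans _ _ (nsq (f i)))//; last first.
  by have := le_l [fset i]%fset; rewrite big_seq_fset1.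
by rewrite -(@ltcR R) nsqE exprn_gt0// normr_gt0.
Qed.

HB.instance Definition _ := bilinear_isBilinear.Build R[i] K K R[i] _ _ l2dot
  (l2dot_linearl, l2dot_linearr).
HB.instance Definition _ := isHermitianSesquilinear.Build R[i] K false
  (@Num.conj R[i]) l2dot l2dot_hermitian.
HB.instance Definition _ := isDotProduct.Build R[i] K l2dot l2dot_gt0.

End L2space.

(** * The norm induced by an inner product *)

Section DotNorm.
Variables (C : numClosedFieldType) (U : lmodType C).
Variable d : {dot U for (@Num.conj C)}.
Local Notation dnorm u := (sqrtC (d u u)).

Lemma dot_CauchySchwarz u v : `|d u v| ^+ 2 <= d u u * d v v.
Proof.
have [->|v0] := eqVneq v 0; first by rewrite !(linear0r d) mulr0 normr0 expr0n.
have dv0 : 0 < d v v by rewrite dnorm_gt0.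
(* This vector is [d v v] times the component of [u] orthogonal to [v]; the scaling avoids a
   division. *)
have := dnorm_ge0 d (d v v *: u - d u v *: v).
have -> : d (d v v *: u - d u v *: v) (d v v *: u - d u v *: v) =
    d v v * (d u u * d v v - `|d u v| ^+ 2).
  have dvr : (d v v)^* = d v v by exact/CrealP/gtr0_real.
  have duv : d v u = (d u v)^* by rewrite (hermC d) mul1r.
  rewrite !(linearBl d) !(linearBr d) !(linearZl_LR d) !(linearZr_LR d)/=.
  by rewrite normCK duv dvr; ring.
by rewrite pmulr_rge0// subr_ge0.
Qed.

Lemma dot_sqrtC_normD u v : dnorm (u + v) <= dnorm u + dnorm v.
Proof.
have h0 w : 0 <= dnorm w by rewrite sqrtC_ge0 dnorm_ge0.
rewrite -(ler_pXn2r (ltn0Sn 1)) ?nnegrE ?addr_ge0 ?h0// sqrtCK dnormD.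
rewrite sqrrD !sqrtCK [leRHS]addrAC lerD2l.
have -> : d u v + (d u v)^* = 'Re (d u v) *+ 2.
  by rewrite ReE -mulr_natr divfK ?pnatr_eq0.
rewrite lerMn2r/=; apply: le_trans (leif_Re_Creal _).1 _.
rewrite -(ler_pXn2r (ltn0Sn 1)) ?nnegrE ?mulr_ge0 ?h0// exprMn !sqrtCK.
exact: dot_CauchySchwarz.
Qed.

Lemma dot_sqrtC_normZ a u : dnorm (a *: u) = `|a| * dnorm u.
Proof. by rewrite dnormZ sqrtCM ?nnegrE ?exprn_ge0 ?dnorm_ge0// sqrCK. Qed.

Lemma dot_sqrtC_norm_eq0 u : dnorm u = 0 -> u = 0.
Proof. by move/eqP; rewrite sqrtC_eq0 dnorm_eq0 => /eqP. Qed.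
End DotNorm.

(** * Completeness of [l2] *)

Section L2Hilbert.
Variables (R : realType) (I : choiceType) (E : hilbertType R).
Local Notation K := (l2 I E).

HB.instance Definition _ := Lmodule_isNormed.Build R[i] K
  (dot_sqrtC_normD (@l2dot R I E)) (dot_sqrtC_normZ (@l2dot R I E))
  (@dot_sqrtC_norm_eq0 _ _ (@l2dot R I E)).

Lemma l2dot_norm (f : K) : l2dot f f = `|f| ^+ 2.
Proof. by rewrite -[X in X ^+ 2]/(sqrtC (l2dot f f)) sqrtCK. Qed.

Lemma l2_norm_leP (f : K) (M : R) : 0 <= M ->
  (forall A : {fset I}, \sum_(i <- A) nsq (f i) <= M ^+ 2) <-> `|f| <= M%:C%C.
Proof.
move=> M0; have [l fl [le_l l_le]] := nsq_sum_cvg f.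
rewrite -(ler_pXn2r (ltn0Sn 1)) ?nnegrE ?ler0c// -l2dot_norm fl -rmorphXn lecR.
by split=> [/l_le//|lM A]; exact: le_trans (le_l A) lM.
Qed.

Lemma l2_coord_le (f : K) i : `|f i| <= `|f|.
Proof.
have [l fl [le_l _]] := nsq_sum_cvg f.
rewrite -(ler_pXn2r (ltn0Sn 1)) ?nnegrE// -nsqE -l2dot_norm fl lecR.
by have := le_l [fset i]%fset; rewrite big_seq_fset1.
Qed.

Lemma nsq_lt (u : E) (e : R) : 0 < e -> `|u| < (Num.sqrt e)%:C%C -> nsq u < e.
Proof.
move=> e0; rewrite -(ltr_pXn2r (ltn0Sn 1)) ?nnegrE ?ler0c ?sqrtr_ge0//.
by rewrite -nsqE -rmorphXn ltcR sqr_sqrtr ?ltW.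
Qed.

Lemma nsq_sum_near (F : set_system K) (l : I -> E) : ProperFilter F ->
  (forall i, (fun f : K => f i) @ F --> l i) ->
  forall (s : seq I) (e : R), 0 < e ->
  \forall f \near F, \sum_(i <- s) nsq (l i - (f : K) i) < e.
Proof.
move=> FF Fl; elim=> [|i s IH] e e0.
  by apply: nearW => f; rewrite big_nil.
have e20 : 0 < e / 2 by rewrite divr_gt0.
have /cvgrPdist_lt/(_ (Num.sqrt (e / 2))%:C%C) := Fl i.
rewrite ltcR sqrtr_gt0 => /(_ e20) i_near.
apply: filterS2 i_near (IH _ e20) => f /(nsq_lt e20) lt1 lt2.
by rewrite big_cons (splitr e) ltrD.
Qed.

Lemma l2_complete (F : set_system K) : ProperFilter F -> cauchy F -> cvg F.
Proof.
move=> FF Fc.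
have Fi i : cvg ((fun f : K => f i) @ F).
  apply/cauchy_cvgP/cauchyP => e e0.
  have /cauchyP/(_ e e0)[f Ff] : cauchy F by [].
  exists (f i).
  apply: (@filterS _ F _ (ball f e) ((fun g : K => g i) @^-1` ball (f i) e)) Ff.
  move=> g; rewrite -!ball_normE/=.
  exact/le_lt_trans/(l2_coord_le (f - g)).
have [l Fl] := choice (fun i => (cvg_ex _).1 (Fi i)).
(* If [f] and [g] are within [e] of [f0], then [|g - f| <= 2 e]. Taking [g] close to [l] on [A]
   bounds the sum by [2 e^2 + 8 e^2], below [(4 e)^2]. *)
have near_l (e : R) : 0 < e -> \forall f \near F, forall A : {fset I},
    \sum_(i <- A) nsq (l i - (f : K) i) <= (4 * e) ^+ 2.
  move=> e0; have eC0 : 0 < e%:C%C :> R[i] by rewrite ltcR.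
  have /cauchyP/(_ _ eC0)[f0 Ff0] : cauchy F by [].
  apply: filterS (Ff0) => f ball_f A.
  have [g [ltA ball_g]] :=
    filter_ex (filterI (nsq_sum_near FF Fl A (exprn_gt0 2 e0)) Ff0).
  have fg : `|g - f| <= (2 * e)%:C%C.
    rewrite -(subrKA f0) (le_trans (ler_normD _ _))// mulr_natl mulr2n rmorphD.
    rewrite lerD//.
      by rewrite distrC; move: ball_g; rewrite -ball_normE => /ltW.
    by move: ball_f; rewrite -ball_normE => /ltW.
  apply: (@le_trans _ _
    (\sum_(i <- A) (2 * nsq (l i - g i) + 2 * nsq (g i - f i)))).
    apply: ler_sum => i _; rewrite -(subrKA (g i)); exact: nsqD.
  rewrite big_split/= -!mulr_sumr.
  have e20 : 0 <= 2 * e by rewrite mulr_ge0// ltW.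
  have := (l2_norm_leP (g - f) e20).2 fg A; rewrite /=.
  move: ltA; nra.
(* A single [f] near the limit suffices: [l] is the sum of [l - f] and [f]. *)
have l2l : square_summable l.
  have [f ff] := filter_ex (near_l 1 ltr01).
  have [M fM] := l2P f.
  have lf : square_summable (fun i => l i - f i) by eexists; exact: ff.
  have := square_summableP 1 lf (l2P f).
  by congr square_summable; apply/funext => i; rewrite scale1r subrK.
pose L : K := L2 (introT (@asboolP _) l2l).
apply/cvg_ex; exists L; apply/cvgrPdist_le => e e0.
have [e' e'0 eE] := nneg_real (ltW e0).
rewrite eE ltcR in e0; have e40 : 0 < e' / 4 by rewrite divr_gt0.
apply: filterS (near_l _ e40) => f ff; rewrite eE; apply/l2_norm_leP => // A.
by have := ff A; rewrite [4 * _]mulrC divfK ?pnatr_eq0.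
Qed.

HB.instance Definition _ := Uniform_isComplete.Build K l2_complete.
HB.instance Definition _ := CompleteNormedModule_isHilbert.Build R K l2dot_norm.

End L2Hilbert.

(** * Basic operators on [l2] *)

Section L2Operators.
Variables (R : realType) (I : choiceType) (E : hilbertType R).
Local Notation K := (l2 I E).

(** The finite sums may run over different index sets, which covers reindexing; passing to suprema
    gives a contraction. *)
Lemma l2_operator (phi : K -> I -> E) :
  (forall a f g i, phi (a *: f + g) i = a *: phi f i + phi g i) ->
  (forall f (A : {fset I}), exists B : {fset I},
     \sum_(i <- A) nsq (phi f i) <= \sum_(i <- B) nsq (f i)) ->
  exists2 U : {linear K -> K}, forall f i, U f i = phi f i & contractive U.
Proof.
move=> phi_lin phi_le.
have phi2 f : phi f \in @l2pred R I E.
  apply/asboolP; have [M fM] := l2P f; exists M => A.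
  by have [B leB] := phi_le f A; exact: le_trans leB (fM B).
pose u f : K := L2 (phi2 f).
have u_lin : linear u by move=> a f g; apply: l2_ext => i; exact: phi_lin.
pose U : {linear K -> K} := HB.pack u (GRing.isLinear.Build _ _ _ _ u u_lin).
exists U => // f.
have [r r0 fE] := nneg_real (normr_ge0 f).
have le_r : `|f| <= r%:C%C by rewrite fE.
rewrite fE; apply/l2_norm_leP => // A; have [B] := phi_le f A.
by move/le_trans; apply; exact: (l2_norm_leP f r0).2.
Qed.

Lemma l2_map (T : {linear E -> E}) : contractive T ->
  exists2 U : {linear K -> K}, forall f i, U f i = T (f i) & contractive U.
Proof.
move=> cT; apply: l2_operator => [a f g i|f A].
  by rewrite -[X in T X]/(a *: f i + g i) linearP.
exists A; apply: ler_sum => i _; rewrite -(@lecR R) !nsqE.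
by rewrite ler_pXn2r ?nnegrE.
Qed.

Lemma l2_restrict (P : pred I) :
  exists2 U : {linear K -> K}, forall f i, U f i = (if P i then f i else 0)
    & contractive U.
Proof.
apply: l2_operator => [a f g i|f A].
  by case: (P i) => //; rewrite scaler0 addr0.
by exists A; apply: ler_sum => i _; case: (P i) => //; rewrite nsq0 nsq_ge0.
Qed.

Lemma l2_reindex_contractive (s : I -> I) : injective s ->
  exists2 U : {linear K -> K}, forall f i, U f i = f (s i) & contractive U.
Proof.
move=> s_inj; apply: l2_operator => [//|f A].
by exists [fset s i | i in A]%fset; rewrite big_imfset/= // => i j _ _ /s_inj.
Qed.

(** A contraction with a contractive inverse is isometric. *)
Lemma l2_reindex (s t : I -> I) : cancel s t -> cancel t s ->
  exists U : {linear K -> K}, [/\ forall f i, U f i = f (s i),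
    isometric U & forall f, exists g, U g = f].
Proof.
move=> st ts.
have [U UE cU] := l2_reindex_contractive (can_inj st).
have [W WE cW] := l2_reindex_contractive (can_inj ts).
have WU : cancel U W by move=> f; apply: l2_ext => i; rewrite WE UE ts.
have UW : cancel W U by move=> f; apply: l2_ext => i; rewrite UE WE st.
exists U; split=> // f; last by exists (W f).
by apply/eqP; rewrite eq_le cU -{1}(WU f) cW.
Qed.

Lemma l2_dotp_eq0 (f g : K) : (forall i, dotp (f i) (g i) = 0) -> dotp f g = 0.
Proof.
move=> fg0; apply: l2dot_unique.
rewrite (_ : (fun A => _) = fun A => 0 : R[i]^o); first exact: cvg_cst.
by apply/funext => A; rewrite big1.
Qed.

Lemma l2_embed (k : I) :
  exists (V : {linear E -> K}) (Vs : {linear K -> E}),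
  [/\ forall h i, V h i = (if i == k then h else 0), forall f, Vs f = f k,
      isometric V & adjoint V Vs].
Proof.
have sum_le (h : E) (A : {fset I}) :
    \sum_(i <- A) nsq (if i == k then h else 0) <= nsq h.
  have [kA|kA] := boolP (k \in A).
    rewrite (big_fsetD1 k kA)/= eqxx big_seq big1 ?addr0// => i.
    by rewrite !inE => /andP[/negbTE->]; rewrite nsq0.
  rewrite big_seq big1 ?nsq_ge0// => i iA.
  case: eqP => [ik|_]; last by rewrite nsq0.
  by rewrite ik (negbTE kA) in iA.
have v2 (h : E) : (fun i => if i == k then h else 0) \in @l2pred R I E.
  by apply/asboolP; exists (nsq h); exact: sum_le.
pose v h : K := L2 (v2 h).
have v_lin : linear v.
  move=> a f g; apply: l2_ext => i /=.
  rewrite -[RHS]/(a *: (if i == k then f else 0) + (if i == k then g else 0)).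
  by case: eqP => //; rewrite scaler0 addr0.
have [V VE] : exists V : {linear E -> K},
    forall h i, V h i = (if i == k then h else 0).
  pose V : {linear E -> K} := HB.pack v (GRing.isLinear.Build _ _ _ _ v v_lin).
  by exists V.
have [Vs VsE] : exists Vs : {linear K -> E}, forall f, Vs f = f k.
  pose w (f : K) : E := f k; have w_lin : linear w by [].
  pose Vs : {linear K -> E} := HB.pack w (GRing.isLinear.Build _ _ _ _ w w_lin).
  by exists Vs.
exists V, Vs; split=> // [h|h f].
  apply/eqP; rewrite eq_le; apply/andP; split; last first.
    by have := l2_coord_le (V h) k; rewrite VE eqxx.
  have [r r0 hE] := nneg_real (normr_ge0 h).
  rewrite hE; apply/l2_norm_leP => // A; under eq_bigr do rewrite VE.
  by apply: le_trans (sum_le h A) _; rewrite -(@lecR R) nsqE hE rmorphXn.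
(* The finite sums are constant once the index set contains [k]. *)
apply: l2dot_unique; apply: cvg_near_cst.
exists [fset k]%fset => // A /=; rewrite fsub1set => kA.
rewrite (big_fsetD1 k kA)/= !VE VsE eqxx big_seq big1 ?addr0// => i.
by rewrite !inE => /andP[/negbTE ik]; rewrite VE ik dotp0l.
Qed.

End L2Operators.

(** * Moebius transforms of a unitary *)

Section Moebius.
Variables (R : realType) (H : hilbertType R).
Implicit Types (Q U W X Y : {linear H -> H}) (p : R[i]).

(* [Q] plays the role of a projection whose kernel [L] is invariant under [W];
   below, congruence modulo [L] is written [Q x = Q y]. *)
Definition semi_invariant Q W := forall x, Q (W x) = Q (W (Q x)).

Lemma linear_map (f : H -> H) : linear f -> exists U, forall x, U x = f x.
Proof.
move=> f_lin.
pose U : {linear H -> H} := HB.pack f (GRing.isLinear.Build _ _ _ _ f f_lin).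
by exists U.
Qed.

Lemma unimodular_scaling p : `|p| = 1 ->
  exists X, [/\ isometric X, onto X & forall x, X x = p *: x].
Proof.
move=> p1.
have [|X XE] := @linear_map (fun x => p *: x).
  by move=> a x y; rewrite scalerDr !scalerA mulrC.
exists X; split=> // x; first by rewrite XE normrZ p1 mul1r.
exists (p^-1 *: x); rewrite XE scalerA mulfV ?scale1r//.
by rewrite -normr_eq0 p1 oner_eq0.
Qed.

Lemma norm_contracted_eq0 p (x : H) : `|p| < 1 -> `|x| <= `|p| * `|x| -> x = 0.
Proof.
move=> p1 x_le; apply/eqP; rewrite -normr_eq0; apply/negPn/negP => x0.
by move: x_le; rewrite ler_pMl ?lt0r ?x0 ?normr_ge0// lt_geF.
Qed.

(** For isometric [W] the vectors [y + p^* W y] and [p y + W y] have equal norms, so sending the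
    first to the second is isometric. It is onto because [p + W] equals [W (1 + p W^-1)], with
    [neumann] applied to [W^-1]. *)
Lemma moebius_transform W p : isometric W -> onto W -> `|p| < 1 ->
  exists X, [/\ isometric X, onto X,
    onto (fun y => y + p^* *: W y) &
    forall y, X (y + p^* *: W y) = p *: y + W y].
Proof.
move=> isoW ontoW p1.
have pc1 : `|p^*| < 1 by rewrite norm_conjC.
have [B BE] : exists B : {linear H -> H}, forall y, B y = y + p^* *: W y.
  apply: linear_map => a x y.
  by rewrite linearP !scalerDr !scalerA [p^* * a]mulrC addrACA.
have ontoB : onto B by move=> y; have [x <-] := neumann isoW pc1 y; exists x.
have normB y : `|B y| = `|p *: y + W y|.
  apply/eqP; rewrite -(@eqrXn2 _ 2)// BE !dotpD2 !normrZ isoW norm_conjC.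
  rewrite dotpZr dotpZl conjCK; apply/eqP; ring.
have injB : injective B.
  move=> x y /eqP; rewrite -subr_eq0 -linearB BE addr_eq0 => /eqP xy.
  apply/eqP; rewrite -subr_eq0; apply/eqP/(norm_contracted_eq0 pc1).
  by rewrite {1}xy normrN normrZ isoW.
have [C BK CK] := linear_inverse injB ontoB.
have [X XE] : exists X, forall x, X x = p *: C x + W (C x).
  apply: linear_map => a x y.
  by rewrite (linearP C) (linearP W) !scalerDr !scalerA [p * a]mulrC addrACA.
exists X; split=> [x|y|y|y].
- by rewrite XE -normB CK.
- have [Wi WK WiK] := linear_inverse (isometric_inj isoW) ontoW.
  have isoWi : isometric Wi by move=> x; rewrite -[LHS]isoW WiK.
  have [u uE] := neumann isoWi p1 (Wi y).
  exists (B u); rewrite XE BK -[RHS]WiK -uE linearD linearZ/= WiK addrC //.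
- by have [x <-] := ontoB y; exists x; rewrite BE.
- by rewrite -BE XE BK.
Qed.

(* [X] is [(p + W) (1 + p^* W)^-1], or the scalar [p] when [`|p| = 1]; the last
   clause is its first-order expansion [p + (1 - |p|^2) W + ...]. *)
Lemma moebius W p : isometric W -> onto W -> `|p| <= 1 ->
  exists X, [/\ isometric X, onto X,
    forall Y, (forall x, Y (W x) = W (Y x)) -> forall x, Y (X x) = X (Y x) &
    forall Q, contractive Q -> (forall x, Q (Q x) = Q x) ->
      semi_invariant Q W -> semi_invariant Q X /\
      forall u v, Q (W u) = Q v -> Q (W v) = 0 ->
        Q (X u) = Q (p *: u + (1 - `|p| ^+ 2) *: v)].
Proof.
move=> isoW ontoW; rewrite le_eqVlt => /orP[/eqP p1|p1].
  have [X [isoX ontoX XE]] := unimodular_scaling p1.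
  exists X; split=> // [Y YW x|Q _ QQ QW]; first by rewrite !XE linearZ.
  split=> [x|u v _ _]; first by rewrite !XE !linearZ/= QQ.
  by rewrite XE p1 expr1n subrr scale0r addr0.
have [X [isoX ontoX ontoB XE]] := moebius_transform isoW ontoW p1.
exists X; split=> // [Y YW x|Q cQ QQ QW].
  have [y <-] := ontoB x.
  by rewrite XE !(linearD Y) !(linearZ_LR Y)/= YW XE.
(* Invariance of [ker Q]: if [y + p^* W y] lies in it, then [Q y = - p^* Q W Q y], so
   [|Q y| <= |p| |Q y|] and [Q y = 0]. *)
have QX0 x : Q x = 0 -> Q (X x) = 0.
  have [y <-] := ontoB x; rewrite XE !(linearD Q) !(linearZ_LR Q)/= => Qx0.
  have Qy0 : Q y = 0.
    apply: (norm_contracted_eq0 p1).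
    have {1}-> : Q y = - (p^* *: Q (W (Q y))).
      by apply/eqP; rewrite -QW -addr_eq0 Qx0.
    by rewrite normrN normrZ norm_conjC ler_wpM2l// (le_trans (cQ _))// isoW.
  have QWy0 : Q (W y) = 0 by rewrite QW Qy0 !linear0.
  by rewrite Qy0 QWy0 scaler0 addr0.
have siX : semi_invariant Q X.
  move=> x; apply/eqP; rewrite -subr_eq0 -(linearB Q) -(linearB X).
  apply/eqP/QX0.
  by rewrite (linearB Q) QQ subrr.
split=> // u v Wu Wv.
(* Modulo [ker Q], [W] sends [u] to [v] and [v] to 0, so this [y] solves [y + p^* W y = u]. *)
pose y := u - p^* *: v.
have QWy : Q (W y) = Q v.
  rewrite (linearB W) (linearZ_LR W) (linearB Q) (linearZ_LR Q)/= Wu Wv.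
  by rewrite scaler0 subr0.
have BE : Q (y + p^* *: W y) = Q u.
  rewrite (linearD Q) (linearZ_LR Q)/= QWy -(linearZ_LR Q) -(linearD Q).
  by rewrite subrK.
rewrite siX -BE -siX XE (linearD Q) QWy -(linearD Q); congr (Q _).
rewrite scalerBr scalerA -normCK -addrA; congr (_ + _).
by rewrite scalerBl scale1r addrC.
Qed.

End Moebius.

(** * Dilation from lifts modulo an invariant subspace *)

Section DilationCriterion.
Variables (R : realType) (H K : hilbertType R) (k : nat).

(** As [ker Q] is invariant under each [U i], the congruences [U i V = V T i] modulo [ker Q]
    multiply to monomials; [Vs] kills [ker Q] and is a left inverse of [V]. *)
Lemma dilates_by_lifting (T : 'I_k -> {linear H -> H})
    (U : 'I_k -> {linear K -> K}) (V : {linear H -> K}) (Vs : {linear K -> H})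
    (Q : {linear K -> K}) :
  isometric V -> adjoint V Vs -> (forall x, Vs (Q x) = Vs x) ->
  (forall i, semi_invariant Q (U i)) ->
  (forall i h, Q (U i (V h)) = Q (V (T i h))) -> dilates U T.
Proof.
move=> isoV adjV VsQ QU UV; exists V, Vs; split=> // m h.
have VsV x : Vs (V x) = x.
  apply/eqP; rewrite -subr_eq0 -normr_eq0 -sqrf_eq0 -dotpE.
  by rewrite dotpDr dotpNr -adjV isometric_dotp// subrr.
(* Quantifying over every [y] congruent to [V x] makes the relation stable under composition. *)
pose lifts (f : H -> H) (g : K -> K) :=
  forall x y, Q y = Q (V x) -> Q (g y) = Q (V (f x)).
suff: lifts (monomial T m) (monomial U m).
  by move=> /(_ h (V h) erefl) e; rewrite /= -VsQ e VsQ VsV.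
apply: (big_ind2 lifts) => [//|f g f' g' fg f'g' x y xy|i _].
  exact/fg/f'g'.
elim: (m i) => [//|n IH] x y xy.
by rewrite !iterS QU (IH _ _ xy) -QU UV.
Qed.

End DilationCriterion.

(** * Orthonormal bases of a plane *)

Section OrthonormalPairs.
Variables (R : realType) (E : hilbertType R).
Implicit Types a b x : E.

(** The expansion clause forces [E] to be two-dimensional. *)
Definition orthonormal_basis2 a b := [/\ `|a| = 1, `|b| = 1, dotp a b = 0 &
  forall x, x = dotp x a *: a + dotp x b *: b].

Lemma orthonormal_basis2C a b :
  orthonormal_basis2 a b -> orthonormal_basis2 b a.
Proof.
move=> [a1 b1 ab0 ab]; split=> // [|x]; last by rewrite addrC -ab.
by rewrite dotpC ab0 conjC0.
Qed.

Lemma dotp_unit a : `|a| = 1 -> dotp a a = 1.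
Proof. by move=> a1; rewrite dotpE a1 expr1n. Qed.

Lemma parseval2 a b x : orthonormal_basis2 a b ->
  `|x| ^+ 2 = `|dotp x a| ^+ 2 + `|dotp x b| ^+ 2.
Proof.
move=> [a1 b1 ab0 ab]; rewrite {1}(ab x) pythagoras.
  by rewrite !normrZ a1 b1 !mulr1.
by rewrite dotpZl dotpZr ab0 !mulr0.
Qed.

Lemma dotp_unit_le a x : `|a| = 1 -> `|dotp x a| <= `|x|.
Proof.
move=> a1; rewrite -(ler_pXn2r (ltn0Sn 1)) ?nnegrE//.
by rewrite (le_trans (dot_CauchySchwarz _ _ _))// !dotpE a1 expr1n mulr1.
Qed.

Lemma rank_one a b : `|a| = 1 -> `|b| = 1 ->
  exists2 T : {linear E -> E}, forall x, T x = dotp x b *: a & contractive T.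
Proof.
move=> a1 b1; have [|T TE] := @linear_map R E (fun x => dotp x b *: a).
  by move=> c x y; rewrite dotpDl dotpZl scalerDl scalerA.
by exists T => // x; rewrite TE normrZ a1 mulr1 dotp_unit_le.
Qed.

Lemma reflection a b : orthonormal_basis2 a b ->
  exists2 J : {linear E -> E}, forall x, J x = dotp x a *: a - dotp x b *: b
    & contractive J.
Proof.
move=> onb; have [a1 b1 ab0 ab] := onb.
have [|J JE] := @linear_map R E (fun x => dotp x a *: a - dotp x b *: b).
  move=> c x y; rewrite !dotpDl !dotpZl !scalerDl scalerBr !scalerA opprD.
  by rewrite addrACA.
exists J => // x; rewrite -(ler_pXn2r (ltn0Sn 1)) ?nnegrE// JE -scaleNr.
rewrite pythagoras ?(parseval2 x onb) ?normrZ ?a1 ?b1 ?mulr1 ?normrN//.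
by rewrite dotpZl dotpZr ab0 !mulr0.
Qed.

End OrthonormalPairs.

Lemma orthonormal_basis2_exists (R : realType) (b : euclidean R 2) : `|b| = 1 ->
  exists b', orthonormal_basis2 b b'.
Proof.
move=> b1.
pose b0 : R[i] := (b : 'rV_2) 0 0; pose b1' : R[i] := (b : 'rV_2) 0 1.
have dotE (x y : euclidean R 2) : dotp x y =
    (x : 'rV_2) 0 0 * ((y : 'rV_2) 0 0)^* +
    (x : 'rV_2) 0 1 * ((y : 'rV_2) 0 1)^*.
  rewrite [LHS]dotmxE mxE !big_ord_recl big_ord0 addr0 !mxE.
  by have -> : lift ord0 ord0 = 1 :> 'I_2 by apply/val_inj.
have normb : b0 * b0^* + b1' * b1'^* = 1 by rewrite -dotE dotpE b1 expr1n.
(* The vector with coordinates [- b1'^*] and [b0^*] spans the orthogonal complement of [b]. *)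
pose b' : euclidean R 2 := (\row_j if j == 0 then - b1'^* else b0^*) : 'rV_2.
have b'0 : (b' : 'rV_2) 0 0 = - b1'^* by rewrite mxE.
have b'1 : (b' : 'rV_2) 0 1 = b0^* by rewrite mxE.
have b'0c : ((b' : 'rV_2) 0 0)^* = - b1' by rewrite b'0 rmorphN/= conjCK.
have b'1c : ((b' : 'rV_2) 0 1)^* = b0 by rewrite b'1 conjCK.
have norm_b' : `|b'| ^+ 2 = 1.
  rewrite -dotpE; apply: etrans (dotE b' b') _.
  by rewrite b'0c b'1c b'0 b'1 -normb; ring.
exists b'; split; first exact: b1.
- by apply/eqP; rewrite -(@eqrXn2 _ 2)// norm_b' expr1n.
- by apply: etrans (dotE b b') _; rewrite b'0c b'1c -/b0 -/b1'; ring.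
- move=> x; apply/rowP => j.
  have -> : dotp x b = (x : 'rV_2) 0 0 * b0^* + (x : 'rV_2) 0 1 * b1'^*.
    exact: dotE.
  have -> : dotp x b' = (x : 'rV_2) 0 0 * - b1' + (x : 'rV_2) 0 1 * b0.
    by apply: etrans (dotE x b') _; rewrite b'0c b'1c.
  set s := (x : 'rV_2) 0 0 * b0^* + _; set t := (x : 'rV_2) 0 0 * - b1' + _.
  transitivity (s * (b : 'rV_2) 0 j + t * (b' : 'rV_2) 0 j).
    2: by rewrite !mxE.
  rewrite /s /t; have [->|->] : j = 0 \/ j = 1.
    by case: j => [[|[|//]] ltj]; [left|right]; apply/val_inj.
  + rewrite b'0 -/b0.
    transitivity ((x : 'rV_2) 0 0 * (b0 * b0^* + b1' * b1'^*)); last by ring.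
    by rewrite normb mulr1.
  + rewrite b'1 -/b1'.
    transitivity ((x : 'rV_2) 0 1 * (b0 * b0^* + b1' * b1'^*)); last by ring.
    by rewrite normb mulr1.
Qed.

Lemma l2_norm_eq (R : realType) (I : choiceType) (E : hilbertType R)
  (f g : l2 I E) : (forall i, `|f i| = `|g i|) -> `|f| = `|g|.
Proof.
move=> fg; apply/eqP; rewrite -(@eqrXn2 _ 2)// -!l2dot_norm; apply/eqP.
apply: l2dot_unique.
rewrite (_ : (fun A => _) = fun A : {fset I} => \sum_(i <- A) dotp (g i) (g i)).
  exact: l2dot_cvg.
by apply/funext => A; apply: eq_bigr => i _; rewrite !dotpE fg.
Qed.

(** * Lifting unitaries on sequences indexed by the integers *)

Section Model.
Variables (R : realType) (E : hilbertType R).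
Local Notation K := (l2 int E).
Variables (z : {linear K -> K}) (V : {linear E -> K}) (Q : {linear K -> K}).
Variable (zE : forall f n, z f n = f (n - 1)).
Variable (isoz : isometric z) (ontoz : onto z).
Variable (VE : forall h n, V h n = if n == 0 then h else 0).
Variable (QE : forall f n, Q f n = if (n <= 0)%R then f n else 0).
Variable (cQ : contractive Q).

(* [V T h - U V h] lies in the [U]-invariant space [ker Q] of the sequences
   supported on the positive integers, so that [T] is the compression of [U]. *)
Definition lifting_unitary (U : {linear K -> K}) (T : E -> E) :=
  [/\ isometric U, onto U, semi_invariant Q U &
      forall h, Q (U (V h)) = Q (V (T h))].

Lemma truncation_idem f : Q (Q f) = Q f.
Proof. by apply: l2_ext => n; rewrite !QE; case: (n <= 0). Qed.

(** Invariance of [ker Q] under [U] lets the congruence for [U'] pass through [U]. *)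
Lemma lifting_unitary_comp U U' T T' : lifting_unitary U T ->
  lifting_unitary U' T' -> lifting_unitary (U \o U') (T \o T').
Proof.
move=> [isoU ontoU QU UV] [isoU' ontoU' QU' UV']; split=> [f|f|f|h] /=.
- by rewrite isoU isoU'.
- by have [g <-] := ontoU f; have [g' <-] := ontoU' g; exists g'.
- by rewrite QU QU' -QU.
- by rewrite QU UV' -QU UV.
Qed.

Lemma eq_lifting_unitary U T T' : T =1 T' -> lifting_unitary U T ->
  lifting_unitary U T'.
Proof. by move=> TT' [isoU ontoU QU UV]; split=> // h; rewrite UV TT'. Qed.

Lemma shift_semi_invariant : semi_invariant Q z.
Proof.
move=> f; apply: l2_ext => n; rewrite !QE !zE QE.
by case: ifP => // n0; rewrite ifT//; lia.
Qed.

Lemma shift_embed h : Q (z (V h)) = 0.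
Proof.
apply: l2_ext => n; rewrite QE zE VE; case: ifP => // n0.
by rewrite ifF//; apply/eqP; lia.
Qed.

(** The shift moves the 0-th fibre to index 1, where [Q] vanishes. *)
Lemma shift_lifting : lifting_unitary z (fun=> 0).
Proof.
split=> // [|h]; first exact: shift_semi_invariant.
by rewrite shift_embed !linear0.
Qed.

(** As [T] squares to zero, the expansion of the Moebius transform stops at first order. The
    commutation clause passes from [W] to [M]. *)
Lemma moebius_lifting W T p : lifting_unitary W T -> (forall h, T (T h) = 0) ->
  `|p| <= 1 -> exists M : {linear K -> K},
  lifting_unitary M (fun h => p *: h + (1 - `|p| ^+ 2) *: T h) /\
  forall Y : {linear K -> K}, (forall f, Y (W f) = W (Y f)) ->
    forall f, Y (M f) = M (Y f).
Proof.
move=> [isoW ontoW QW WV] TT p1.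
have [M [isoM ontoM MC MQ]] := moebius isoW ontoW p1.
have [QM ME] := MQ Q cQ truncation_idem QW.
exists M; split=> //; split=> // h.
rewrite (ME (V h) (V (T h)) (WV h)); last by rewrite WV TT !linear0.
by rewrite (linearD V) !(linearZ_LR V).
Qed.

Lemma moebius_shift p : `|p| <= 1 -> exists M : {linear K -> K},
  lifting_unitary M (fun h => p *: h) /\
  forall Y : {linear K -> K}, (forall f, Y (z f) = z (Y f)) ->
    forall f, Y (M f) = M (Y f).
Proof.
move=> p1; have [//|M [MV MC]] := moebius_lifting shift_lifting _ p1.
exists M; split=> //; apply: eq_lifting_unitary MV => h.
by rewrite scaler0 addr0.
Qed.

Section CrossedShift.
Variables a a' b b' : E.

(** The operator [a b^* + z a' b'^*], that is, multiplication by a unitary-valued inner function. *)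
Definition crossed_shift (S : K -> K) :=
  forall f n, S f n = dotp (f n) b *: a + dotp (f (n - 1)) b' *: a'.

Variable (onba : orthonormal_basis2 a a') (onbb : orthonormal_basis2 b b').

Lemma crossed_shift_exists :
  exists S : {linear K -> K}, crossed_shift S /\ isometric S.
Proof.
have [a1 a'1 aa'0 aa'] := onba; have [b1 b'1 bb'0 bb'] := onbb.
have rank_one_map u v : `|u| = 1 -> `|v| = 1 ->
    exists A : {linear K -> K}, forall f n, A f n = dotp (f n) v *: u.
  move=> u1 v1; have [T TE cT] := rank_one u1 v1.
  by have [A AE _] := l2_map int cT; exists A => f n; rewrite AE TE.
(* [B1] and [B2] split [f] along [b] and [b']; [A1] and [A2] carry these parts isometrically to the
   orthogonal directions [a] and [a']. *)
have [A1 A1E] := rank_one_map _ _ a1 b1.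
have [A2 A2E] := rank_one_map _ _ a'1 b'1.
have [B1 B1E] := rank_one_map _ _ b1 b1.
have [B2 B2E] := rank_one_map _ _ b'1 b'1.
have [|S SE] := @linear_map R K (fun f => A1 f + z (A2 f)).
  move=> c f g; rewrite (linearP A1) (linearP A2) (linearP z).
  by rewrite scalerDr addrACA.
exists S; split=> [f n|f]; first by rewrite SE l2D A1E zE A2E.
have Sorth : dotp (A1 f) (z (A2 f)) = 0.
  apply: l2_dotp_eq0 => n; rewrite zE A1E A2E dotpZl dotpZr aa'0.
  by rewrite !mulr0.
have Borth : dotp (B1 f) (B2 f) = 0.
  by apply: l2_dotp_eq0 => n; rewrite B1E B2E dotpZl dotpZr bb'0 !mulr0.
have fE : f = B1 f + B2 f by apply: l2_ext => n; rewrite l2D B1E B2E.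
apply/eqP; rewrite -(@eqrXn2 _ 2)// SE (pythagoras Sorth) [in eqbRHS]fE.
rewrite (pythagoras Borth) isoz; apply/eqP; congr (_ ^+ 2 + _ ^+ 2).
  by apply: l2_norm_eq => n; rewrite A1E B1E !normrZ a1 b1.
by apply: l2_norm_eq => n; rewrite A2E B2E !normrZ a'1 b'1.
Qed.

Lemma crossed_shift_semi_invariant (S : {linear K -> K}) :
  crossed_shift S -> semi_invariant Q S.
Proof.
move=> SE f; apply: l2_ext => n; rewrite !QE !SE !QE.
by case: ifP => // n0; rewrite ifT//; lia.
Qed.

Lemma crossed_shift_embed (S : {linear K -> K}) : crossed_shift S ->
  forall h, Q (S (V h)) = Q (V (dotp h b *: a)).
Proof.
move=> SE h; apply: l2_ext => n; rewrite !QE SE !VE; case: ifP => // n0.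
have -> : (n - 1 == 0) = false by apply/eqP; lia.
by rewrite dotp0l scale0r addr0; case: ifP; rewrite ?dotp0l ?scale0r.
Qed.

Lemma crossed_shift_comm (S : {linear K -> K}) : crossed_shift S ->
  forall f, S (z f) = z (S f).
Proof. by move=> SE f; apply: l2_ext => n; rewrite zE !SE !zE. Qed.

End CrossedShift.

(* The crossed shifts of [(a, a', b, b')] and [(b', b, a', a)] factor [z]. *)
Lemma crossed_shift_factor (S S' : {linear K -> K}) a a' b b' :
  orthonormal_basis2 a a' -> orthonormal_basis2 b b' ->
  crossed_shift a a' b b' S -> crossed_shift b' b a' a S' ->
  forall f, S (S' f) = z f.
Proof.
move=> [_ _ _ aa'] [b1 b'1 bb'0 _] SE S'E f; apply: l2_ext => n.
have b'b0 : dotp b' b = 0 by rewrite dotpC bb'0 conjC0.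
rewrite SE !S'E zE !dotpDl !dotpZl bb'0 b'b0 (dotp_unit b1) (dotp_unit b'1).
by rewrite !(mulr0, mulr1, addr0, add0r) -aa'.
Qed.

Lemma crossed_shift_lifting (S : {linear K -> K}) a a' b b' :
  orthonormal_basis2 a a' -> orthonormal_basis2 b b' ->
  crossed_shift a a' b b' S -> isometric S ->
  lifting_unitary S (fun h => dotp h b *: a).
Proof.
move=> onba onbb SE isoS; split=> //.
(* Surjectivity follows from [S S' = z], as [z] is onto. *)
- have [S' [S'E _]] := crossed_shift_exists (orthonormal_basis2C onbb)
    (orthonormal_basis2C onba).
  move=> f; have [g <-] := ontoz f; exists (S' g).
  exact: (crossed_shift_factor onba onbb SE S'E).
- exact: crossed_shift_semi_invariant SE.
- exact: crossed_shift_embed SE.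
Qed.

(** The reversed crossed shift [S'] lifts [b' a'^*] and commutes with [S], both products being [z];
    a Moebius transform of [z] supplies the scalar [t]. *)
Lemma special_commuting (S : {linear K -> K}) a a' b b' t :
  orthonormal_basis2 a a' -> orthonormal_basis2 b b' ->
  crossed_shift a a' b b' S -> `|t| <= 1 ->
  exists X : {linear K -> K},
    [/\ lifting_unitary X (fun h => (t * dotp h a') *: b'),
        forall f, X (z f) = z (X f) & forall f, X (S f) = S (X f)].
Proof.
move=> onba onbb SE t1.
have [onba' onbb'] := (orthonormal_basis2C onba, orthonormal_basis2C onbb).
have [S' [S'E isoS']] := crossed_shift_exists onbb' onba'.
have [M [MV MC]] := moebius_shift t1.
have zM f : z (M f) = M (z f) by exact: MC.
have SM f : S (M f) = M (S f) by apply: MC; exact: crossed_shift_comm SE.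
exists (S' \o M); split=> [|f|f] /=.
- apply: eq_lifting_unitary (lifting_unitary_comp
    (crossed_shift_lifting onbb' onba' S'E isoS') MV) => h /=.
  by rewrite dotpZl.
- by rewrite -zM (crossed_shift_comm S'E).
- rewrite -SM (crossed_shift_factor onbb' onba' S'E SE).
  by rewrite (crossed_shift_factor onba onbb SE S'E).
Qed.

(* [J] is the reflection exchanging the signs of [b'] and [b] in every fibre; it
   anticommutes with [S], and the operator sought is [phi(S) J] for the Schur
   function [phi] whose expansion at 0 is [p + (1 - |p|^2) r z + ...]. *)
Lemma special_anticommuting (S : {linear K -> K}) b b' p r :
  orthonormal_basis2 b b' -> crossed_shift b' b b b' S -> isometric S ->
  `|p| <= 1 -> `|r| <= 1 -> exists X : {linear K -> K},
    [/\ lifting_unitary X (fun h => (p * dotp h b' -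
             (1 - `|p| ^+ 2) * r * dotp h b) *: b' - (p * dotp h b) *: b),
        forall f, X (z f) = z (X f) & forall f, X (S f) = - S (X f)].
Proof.
move=> onbb SE isoS p1 r1; have [b1 b'1 bb'0 bb'] := onbb.
have onbb' := orthonormal_basis2C onbb.
have b'b0 : dotp b' b = 0 by rewrite dotpC bb'0 conjC0.
have SV := crossed_shift_lifting onbb' onbb SE isoS.
have zS f : z (S f) = S (z f) by rewrite (crossed_shift_comm SE).
have SS0 h : dotp (dotp h b *: b') b *: b' = 0.
  by rewrite dotpZl b'b0 mulr0 scale0r.
(* [M] has constant term [r], so [S M] has constant term 0 and first-order coefficient [r] as a
   function of [S]: it lifts [r b' b^*]. *)
have [M [MV MC]] := moebius_lifting SV SS0 r1.
pose W : {linear K -> K} := S \o M.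
have WV : lifting_unitary W (fun h => (r * dotp h b) *: b').
  apply: eq_lifting_unitary (lifting_unitary_comp SV MV) => h /=.
  by rewrite dotpDl !dotpZl b'b0 !mulr0 addr0.
have WW0 h : (r * dotp ((r * dotp h b) *: b') b) *: b' = 0.
  by rewrite dotpZl b'b0 !mulr0 scale0r.
(* [F] is [phi(S)]: it lifts [p + (1 - |p|^2) r b' b^*]. *)
have [F [FV FC]] := moebius_lifting WV WW0 p1.
have zF f : z (F f) = F (z f).
  by apply: FC => g /=; rewrite zS; congr (S _); exact: MC.
have SF f : S (F f) = F (S f).
  by apply: FC => g /=; congr (S _); exact: MC.
have [J0 J0E cJ0] := reflection onbb'.
have [J JE cJ] := l2_map int cJ0.
have JJ f : J (J f) = f.
  apply: l2_ext => n; rewrite !JE !J0E !(dotpDl, dotpNl, dotpZl) (dotp_unit b1).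
  rewrite (dotp_unit b'1) bb'0 b'b0 !(mulr0, mulr1, subr0, sub0r) scaleNr opprK.
  by rewrite addrC -bb'.
have JV : lifting_unitary J J0.
  split=> [f|f|f|h]; first 1 last.
  - by exists (J f).
  - by apply: l2_ext => n; rewrite !QE !JE QE; case: ifP.
  - congr (Q _); apply: l2_ext => n; rewrite JE !VE; case: ifP => // _.
    exact: linear0.
  - by apply/eqP; rewrite eq_le cJ -{1}(JJ f) cJ.
have zJ f : z (J f) = J (z f) by apply: l2_ext => n; rewrite zE !JE zE.
have SJ f : J (S f) = - S (J f).
  apply: l2_ext => n; rewrite -[RHS]/(- S (J f) n) JE !SE J0E !JE !J0E.
  rewrite !(dotpDl, dotpNl, dotpZl) (dotp_unit b1) (dotp_unit b'1) bb'0 b'b0.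
  by rewrite !(mulr0, mulr1, subr0, sub0r, addr0, add0r) scaleNr opprD opprK.
exists (F \o J); split=> [|f|f] /=.
- apply: eq_lifting_unitary (lifting_unitary_comp FV JV) => h /=.
  rewrite J0E !(dotpDl, dotpNl, dotpZl) (dotp_unit b1) b'b0.
  rewrite !(mulr0, mulr1, sub0r) scalerBr !scalerA addrAC -scalerDl.
  by rewrite !mulrN mulrA.
- by rewrite zF zJ.
- by rewrite SJ (linearN F) SF.
Qed.

Variable Vs : {linear K -> E}.
Variable (isoV : isometric V) (adjV : adjoint V Vs).
Variable (VsE : forall f, Vs f = f 0).

(** Off [i0] the lifts are [S M], with [M] a Moebius transform of [z], so they commute with each
    other; their relation with [X] is the sign [e] relating [X] and [S]. *)
Lemma dilation_from_special (k : nat) (T : 'I_k -> {linear E -> E})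
    (S X : {linear K -> K}) (a a' b b' : E) (t : 'I_k -> R[i]) (i0 : 'I_k)
    (e : R[i]) :
  orthonormal_basis2 a a' -> orthonormal_basis2 b b' ->
  crossed_shift a a' b b' S -> isometric S ->
  (forall l, l != i0 ->
     `|t l| <= 1 /\ forall x, T l x = (t l * dotp x b) *: a) ->
  lifting_unitary X (T i0) -> (forall f, X (z f) = z (X f)) ->
  (forall f, X (S f) = e *: S (X f)) -> e = 1 \/ e = -1 ->
  exists (G : hilbertType R) (U : 'I_k -> {linear G -> G})
         (q : 'I_k -> 'I_k -> R[i]),
    [/\ pm1_valued q, q_commuting q U, (forall i, unitary (U i))
      & dilates U T].
Proof.
move=> onba onbb SE isoS TE XV Xz XS e_pm1.
have SV := crossed_shift_lifting onba onbb SE isoS.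
have zS f : z (S f) = S (z f) by rewrite (crossed_shift_comm SE).
have ee : e * e = 1 by case: e_pm1 => ->; rewrite ?mulrNN mulr1.
(* The commutation clause is stated for arbitrary [Y] because it is applied to [z], [S], [X] and the
   other lifts. *)
have /choice[U UP] l : exists U : {linear K -> K},
    lifting_unitary U (T l) /\
    if l == i0 then U = X else forall (Y : {linear K -> K}) c,
      (forall f, Y (z f) = z (Y f)) -> (forall f, Y (S f) = c *: S (Y f)) ->
      forall f, Y (U f) = c *: U (Y f).
  have [->|li0] := eqVneq l i0; first by exists X.
  have [tl1 TlE] := TE l li0.
  have [M [MV MC]] := moebius_shift tl1.
  exists (S \o M); split.
    apply: eq_lifting_unitary (lifting_unitary_comp SV MV) => h /=.
    by rewrite TlE dotpZl.
  by move=> Y c Yz YS f /=; rewrite YS MC.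
have UV l := (UP l).1.
have Uz l f : U l (z f) = z (U l f).
  have := (UP l).2; case: eqVneq => [_ ->//|_ UC].
  have := UC z 1 (fun f => erefl) _ f; rewrite scale1r => ->// g.
  by rewrite scale1r.
have US l f : l != i0 -> U l (S f) = S (U l f).
  move=> li0; have := (UP l).2; rewrite (negbTE li0) => UC.
  have := UC S 1 _ _ f; rewrite scale1r => ->// g.
  by rewrite scale1r.
pose q (i j : 'I_k) : R[i] := if (i == i0) || (j == i0) then e else 1.
exists K, U, q; split.
- by move=> i j _; rewrite /q; case: ifP => _; [|left].
- split=> [i j _|i j ij f].
    rewrite /q orbC; case: ifP => _; last by rewrite normr1 invr1.
    by case: e_pm1 => ->; rewrite ?normrN ?invrN normr1 invr1.
  have ne : i != j by rewrite neq_ltn ij.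
  have XU l : l != i0 -> X (U l f) = e *: U l (X f).
    by move=> li0; have := (UP l).2; rewrite (negbTE li0) => UC; exact: UC.
  rewrite /q; have [ii0|ii0] := eqVneq i i0.
    have ji0 : j != i0 by rewrite -ii0 eq_sym.
    have -> : U i = X by have := (UP i).2; rewrite ii0 eqxx.
    exact: XU.
  (* Here the relation is read backwards, which uses [e * e = 1]. *)
  have [ji0|ji0] := eqVneq j i0.
    have -> : U j = X by have := (UP j).2; rewrite ji0 eqxx.
    by rewrite XU// scalerA ee scale1r.
  have := (UP j).2; rewrite (negbTE ji0) => UC.
  by rewrite (UC (U i) 1)// => g; rewrite scale1r US.
- by move=> i; have [isoU ontoU _ _] := UV i; exact: isometric_onto_unitary.
- apply: (dilates_by_lifting isoV adjV (Q := Q)) => [f|i|i h].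
  + by rewrite !VsE QE lexx.
  + by have [] := UV i.
  + by have [] := UV i.
Qed.

End Model.

(** * Dilations of the two normal forms *)

Section PairModels.
Variables (R : realType) (E : hilbertType R) (k : nat).
Variable T : 'I_k -> {linear E -> E}.

Definition has_pm1_dilation := exists (K : hilbertType R)
    (U : 'I_k -> {linear K -> K}) (q : 'I_k -> 'I_k -> R[i]),
  [/\ pm1_valued q, q_commuting q U, (forall i, unitary (U i)) & dilates U T].

Lemma shift_model : exists (z : {linear l2 int E -> l2 int E})
    (V : {linear E -> l2 int E}) (Vs : {linear l2 int E -> E})
    (Q : {linear l2 int E -> l2 int E}),
  [/\ [/\ forall f n, z f n = f (n - 1), isometric z & onto z],
      [/\ forall h n, V h n = if n == 0 then h else 0, isometric V,
          adjoint V Vs & forall f, Vs f = f 0],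
      forall f n, Q f n = (if n <= 0 then f n else 0) & contractive Q].
Proof.
have sub1K : cancel (fun n : int => n - 1) (fun n => n + 1).
  by move=> n; rewrite subrK.
have add1K : cancel (fun n : int => n + 1) (fun n => n - 1).
  by move=> n; rewrite addrK.
have [z [zE isoz ontoz]] := l2_reindex E sub1K add1K.
have [V [Vs [VE VsE isoV adjV]]] := l2_embed E (0 : int).
have [Q QE cQ] := l2_restrict E (fun n : int => n <= 0).
by exists z, V, Vs, Q.
Qed.

Variable i0 : 'I_k.
Variable t : 'I_k -> R[i].

(** The products of [b' a'^*] with [a b^*] vanish in both orders, so commuting lifts are compatible
    with the tuple. *)
Lemma commuting_dilation a a' b b' u :
  orthonormal_basis2 a a' -> orthonormal_basis2 b b' ->
  (forall l, l != i0 ->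
     `|t l| <= 1 /\ forall x, T l x = (t l * dotp x b) *: a) ->
  `|u| <= 1 -> (forall x, T i0 x = (u * dotp x a') *: b') -> has_pm1_dilation.
Proof.
move=> onba onbb TE u1 Ti0.
have [z [V [Vs [Q [[zE isoz ontoz] [VE isoV adjV VsE] QE cQ]]]]] := shift_model.
have [S [SE isoS]] := crossed_shift_exists zE isoz onba onbb.
have [X [XV Xz XS]] :=
  special_commuting zE isoz ontoz VE QE cQ onba onbb SE u1.
apply: (dilation_from_special zE isoz ontoz VE QE cQ isoV adjV VsE onba onbb
  SE isoS TE _ Xz (e := 1)); last by left.
  by apply: eq_lifting_unitary XV => x; rewrite Ti0.
by move=> f; rewrite scale1r XS.
Qed.

(** In the basis [b', b] the exceptional operator is upper triangular with diagonal [p, -p], the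
    form provided by [special_anticommuting]. *)
Lemma anticommuting_dilation b b' p r : orthonormal_basis2 b b' ->
  (forall l, l != i0 ->
     `|t l| <= 1 /\ forall x, T l x = (t l * dotp x b) *: b') ->
  `|p| <= 1 -> `|r| <= 1 ->
  (forall x, T i0 x = (p * dotp x b' - (1 - `|p| ^+ 2) * r * dotp x b) *: b' -
     (p * dotp x b) *: b) -> has_pm1_dilation.
Proof.
move=> onbb TE p1 r1 Ti0; have onbb' := orthonormal_basis2C onbb.
have [z [V [Vs [Q [[zE isoz ontoz] [VE isoV adjV VsE] QE cQ]]]]] := shift_model.
have [S [SE isoS]] := crossed_shift_exists zE isoz onbb' onbb.
have [X [XV Xz XS]] :=
  special_anticommuting zE isoz ontoz VE QE cQ onbb SE isoS p1 r1.
apply: (dilation_from_special zE isoz ontoz VE QE cQ isoV adjV VsE onbb' onbb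
  SE isoS TE _ Xz (e := -1)); last by right.
  by apply: eq_lifting_unitary XV => x; rewrite Ti0.
by move=> f; rewrite scaleN1r XS.
Qed.

End PairModels.

(** * Normal forms of anticommuting contractions on a plane *)

Lemma contractive_triangular (R : realType) (p q : R[i]) :
  (forall c d,
     `|p * c + q * d| ^+ 2 + `|p * d| ^+ 2 <= `|c| ^+ 2 + `|d| ^+ 2) ->
  `|p| <= 1 /\ exists2 r, `|r| <= 1 & q = - ((1 - `|p| ^+ 2) * r).
Proof.
move=> pq.
have p1 : `|p| <= 1.
  have := pq 1 0; rewrite !mulr0 mulr1 addr0 normr0 expr0n/= !addr0 normr1.
  by rewrite ler_pXn2r ?nnegrE.
split=> //; set m := 1 - `|p| ^+ 2.
have m0 : 0 <= m by rewrite subr_ge0 exprn_ile1.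
have normm : `|m| = m by rewrite ger0_norm.
have q_le : `|q| <= m.
  have [mz|mN0] := eqVneq m 0.
    have := pq 0 1; rewrite mulr0 add0r !mulr1 normr0 normr1 expr0n/= add0r.
    rewrite expr1n -lerBrDr -/m mz => q0.
    by rewrite -(@ler_pXn2r _ 2)// ?nnegrE// expr0n.
  have m_gt0 : 0 < m by rewrite lt0r mN0.
  (* On this test vector the first coordinate collapses to [q], and the inequality becomes
     [m |q|^2 <= m m^2]. *)
  have := pq (p^* * q) m.
  have -> : p * (p^* * q) + q * m = q by rewrite /m normCK; ring.
  rewrite !normrM norm_conjC normm !exprMn -lerBrDr -addrA -mulNr -lerBlDl.
  have -> : `|q| ^+ 2 - `|p| ^+ 2 * `|q| ^+ 2 = m * `|q| ^+ 2.
    by rewrite /m; ring.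
  have -> : m ^+ 2 + - `|p| ^+ 2 * m ^+ 2 = m * m ^+ 2 by rewrite /m; ring.
  by rewrite ler_pM2l// ler_pXn2r ?nnegrE.
(* If [m = 0] the quotient is 0 by convention, and [q = 0] as well. *)
exists (- (q / m)).
  have [->|mN0] := eqVneq m 0; first by rewrite invr0 mulr0 oppr0 normr0.
  by rewrite normrN normrM normfV normm ler_pdivrMr ?mul1r// lt0r mN0.
have [mz|mN0] := eqVneq m 0; last by rewrite mulrN opprK mulrC divfK.
by rewrite mz mul0r oppr0; apply/eqP; rewrite -normr_le0 -mz.
Qed.

Section PlaneOperators.
Variables (R : realType) (E : hilbertType R).
Variable planeE : forall e : E, `|e| = 1 -> exists e', orthonormal_basis2 e e'.

Lemma unit_multiple (x : E) : x != 0 -> exists2 e : E, `|e| = 1 & x = `|x| *: e.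
Proof.
move=> x0; have nx0 : `|x| != 0 by rewrite normr_eq0.
exists (`|x|^-1 *: x); last by rewrite scalerA mulfV// scale1r.
by rewrite normrZ normfV normr_id mulVf.
Qed.

(** Normalizing the kernel vector gives [b'], and only the component along its orthogonal complement
    [b] survives under [T]. *)
Lemma singular_rank_one (T : {linear E -> E}) (x : E) : x != 0 -> T x = 0 ->
  exists b b' : E, [/\ orthonormal_basis2 b b', T b' = 0 &
    forall y, T y = dotp y b *: T b].
Proof.
move=> x0 Tx0; have [b' b'1 xE] := unit_multiple x0.
have [b onb] := planeE b'1.
have Tb'0 : T b' = 0.
  move: Tx0; rewrite xE (linearZ_LR T) => /eqP.
  by rewrite scaler_eq0 normr_eq0 (negbTE x0) => /eqP.
exists b, b'; split=> // [|y]; first exact: orthonormal_basis2C.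
have [_ _ _ /(_ y) yE] := onb.
by rewrite {1}yE (linearD T) !(linearZ_LR T) Tb'0 scaler0 add0r.
Qed.

Lemma dilation_of_singular (k : nat) (T : 'I_k -> {linear E -> E}) j (d : E) :
  anti_commuting T -> (forall i, contractive (T i)) ->
  ~ (T j =1 \0) -> d != 0 -> T j d = 0 -> has_pm1_dilation T.
Proof.
move=> antiT cT Tj0 d0 Tjd0.
have anti i l y : i != l -> T i (T l y) = - T l (T i y).
  rewrite neq_ltn => /orP[il|li]; first exact: antiT.
  by rewrite (antiT l i li) opprK.
have [b [b' [onbb Tjb' TjE]]] := singular_rank_one d0 Tjd0.
have w0 : T j b != 0.
  by apply/eqP => Tjb; apply: Tj0 => y; rewrite TjE Tjb scaler0.
have onbb' := orthonormal_basis2C onbb.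
have [b1 b'1 bb'0 bb'] := onbb.
set w := T j b in w0 TjE.
have TbE i x : T i x = dotp x b *: T i b + dotp x b' *: T i b'.
  by rewrite {1}(bb' x) (linearD (T i)) !(linearZ_LR (T i)).
(* Anticommutation with [T j] written as [w b^*]; evaluating at [b'] and at [b] gives [Tb'b] and
   [Tw]. *)
have twist i x : i != j -> dotp x b *: T i w = - (dotp (T i x) b *: w).
  by move=> ij; have := anti i j x ij; rewrite !TjE (linearZ_LR (T i)).
have Tb'b i : i != j -> dotp (T i b') b = 0.
  move=> ij; have := twist i b' ij.
  rewrite [dotp b' b]dotpC bb'0 conjC0 scale0r.
  move/eqP; rewrite eq_sym oppr_eq0 scaler_eq0 (negbTE w0) orbF.
  by move/eqP.
have Tw i : i != j -> T i w = - (dotp (T i b) b *: w).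
  by move=> ij; have := twist i b ij; rewrite (dotp_unit b1) scale1r.
have dotpT_le i x e : `|x| = 1 -> `|e| = 1 -> `|dotp (T i x) e| <= 1.
  by move=> x1 e1; rewrite -x1 (le_trans (dotp_unit_le _ e1))// cT.
(* If [T j] is not nilpotent, every other [T i] satisfies
   [T i * T j = T j * T i = 0]. *)
have [wb0|wb0] := eqVneq (dotp w b) 0; last first.
  (* Pairing [Tw] with [b] gives [2 <w, b> <T i b, b> = 0]. *)
  have Tbb i : i != j -> dotp (T i b) b = 0.
    move=> ij; have := congr1 (fun v => dotp v b) (Tw i ij).
    rewrite {1}(bb' w) (linearD (T i)) !(linearZ_LR (T i)).
    rewrite dotpDl dotpNl !dotpZl.
    rewrite (Tb'b i ij) mulr0 addr0 mulrC => /eqP; rewrite -addr_eq0 -mulr2n.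
    by rewrite -mulrnAl mulf_eq0 (negbTE wb0) orbF mulrn_eq0/= => /eqP.
  have [a a1 wE] := unit_multiple w0.
  have [a' onba] := planeE a1.
  have Ta i : i != j -> T i a = 0.
    move=> ij; have := Tw i ij; rewrite (Tbb i ij) scale0r oppr0 {1}wE.
    rewrite (linearZ_LR (T i)) => /eqP.
    by rewrite scaler_eq0 normr_eq0 (negbTE w0) => /eqP.
  have [_ a'1 _ aa'] := onba.
  (* The roles are exchanged: the other operators are multiples of [b' a'^*], and [T j], equal to
     [|w| a b^*], is exceptional. *)
  apply: (@commuting_dilation _ _ _ T j (fun l => dotp (T l a') b')
    b' b a' a `|w| onbb' (orthonormal_basis2C onba)) => [l lj||x].
  - split=> [|x]; first exact: dotpT_le.
    have -> : T l x = dotp x a' *: T l a'.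
      rewrite {1}(aa' x) (linearD (T l)) !(linearZ_LR (T l)) (Ta l lj).
      by rewrite scaler0 add0r.
    have Tab : dotp (T l a') b = 0.
      by rewrite TbE dotpDl !dotpZl (Tbb l lj) (Tb'b l lj) !mulr0 addr0.
    by rewrite {1}(bb' (T l a')) Tab scale0r add0r scalerA mulrC.
  - by rewrite ger0_norm// (le_trans (cT j b))// b1.
  - by rewrite TjE {1}wE scalerA mulrC.
(* If [T j] is nilpotent, all the operators are upper triangular in the basis
   [(b', b)] with diagonal [(- s i, s i)], and at most one [s i] is nonzero. *)
have [s sE] : exists s : 'I_k -> R[i], forall i, s i = dotp (T i b) b.
  by exists (fun i => dotp (T i b) b).
have [c cE] : exists c : 'I_k -> R[i], forall i, c i = dotp (T i b) b'.
  by exists (fun i => dotp (T i b) b').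
have wE : w = dotp w b' *: b' by rewrite {1}(bb' w) wb0 scale0r add0r.
have wb'0 : dotp w b' != 0.
  by apply: contra_neq w0 => wb'0; rewrite wE wb'0 scale0r.
have Tb' i : T i b' = - s i *: b'.
  have [->|ij] := eqVneq i j; first by rewrite Tjb' sE -/w wb0 oppr0 scale0r.
  have := Tw i ij; rewrite {1 2}wE (linearZ_LR (T i)) -(sE i) => e.
  apply: (scalerI wb'0); rewrite e scaleNr scalerN !scalerA mulrC //.
have Tb i : T i b = c i *: b' + s i *: b.
  by rewrite addrC cE sE; exact: bb'.
have TTb' i l : T i (T l b') = (s i * s l) *: b'.
  by rewrite (Tb' l) (linearZ_LR (T i)) (Tb' i) scalerA mulrNN mulrC.
have ss i l : i != l -> s i * s l = 0.
  move=> il; have /eqP := anti i l b' il.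
  rewrite (TTb' i l) (TTb' l i) [s l * s i]mulrC -addr_eq0 -scalerDl scaler_eq0.
  rewrite -(normr_eq0 b') b'1 oner_eq0 orbF -mulr2n mulrn_eq0/=.
  by move/eqP.
have [i0 i0P] : exists i0, forall l, l != i0 -> s l = 0.
  have [[i0 si0]|none] := pselect (exists i, s i != 0).
    exists i0 => l li0; have /eqP := ss l i0 li0.
    by rewrite mulf_eq0 (negbTE si0) orbF => /eqP.
  (* If every [s] vanishes, any index can be singled out. *)
  by exists j => l _; apply/eqP/negPn/negP => sl; apply: none; exists l.
have TE i x : T i x = (c i * dotp x b - s i * dotp x b') *: b' +
    (s i * dotp x b) *: b.
  rewrite TbE Tb' Tb scalerDr !scalerA scalerBl mulrN scaleNr.
  by rewrite [c i * _]mulrC [s i * dotp x b']mulrC [s i * _]mulrC addrAC.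
(* In the basis [b', b] the diagonal of [T i0] is [- s i0, s i0] and the corner is [c i0]; the sign
   of the second entry does not affect norms. *)
have [|p1 [r r1 rE]] := @contractive_triangular _ (- s i0) (c i0).
  move=> u v; pose x := u *: b' + v *: b.
  have b'b0 : dotp b' b = 0 by rewrite dotpC bb'0 conjC0.
  have xb : dotp x b = v.
    by rewrite dotpDl !dotpZl b'b0 (dotp_unit b1) mulr0 mulr1 add0r.
  have xb' : dotp x b' = u.
    by rewrite dotpDl !dotpZl bb'0 (dotp_unit b'1) mulr0 mulr1 addr0.
  have Txb : dotp (T i0 x) b = s i0 * v.
    by rewrite TE xb xb' dotpDl !dotpZl b'b0 (dotp_unit b1) mulr0 mulr1 add0r.
  have Txb' : dotp (T i0 x) b' = c i0 * v - s i0 * u.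
    by rewrite TE xb xb' dotpDl !dotpZl bb'0 (dotp_unit b'1) mulr0 mulr1 addr0.
  have := cT i0 x; rewrite -(@ler_pXn2r _ 2) ?nnegrE// !(parseval2 _ onbb').
  by rewrite xb xb' Txb Txb' !mulNr normrN [- (s i0 * u) + _]addrC.
have Tl l : l != i0 -> `|c l| <= 1 /\ forall x, T l x = (c l * dotp x b) *: b'.
  move=> li0; split=> [|x]; first by rewrite cE; exact: dotpT_le.
  by rewrite TE (i0P l li0) !mul0r subr0 scale0r addr0.
apply: (anticommuting_dilation onbb Tl p1 r1) => x.
rewrite TE; move: (dotp x b) (dotp x b') => y y'.
rewrite [- s i0 * y]mulNr scaleNr opprK; congr (_ *: _ + _).
by rewrite rE; ring.
Qed.

End PlaneOperators.

(** * Specialization to the Euclidean plane *)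

Lemma kernel_of_not_bijective (R : realType)
    (T : {linear euclidean R 2 -> euclidean R 2}) :
  ~ bijective T -> exists2 x, x != 0 & T x = 0.
Proof.
(* Reading [T] on plain row vectors gives access to its matrix, whose determinant decides
   bijectivity. *)
move=> nbijT; pose f (u : 'rV[R[i]]_2) : 'rV[R[i]]_2 := T u.
have f_lin : linear f by move=> c u v; exact: (linearP T).
pose F : {linear 'rV[R[i]]_2 -> 'rV[R[i]]_2} :=
  HB.pack f (GRing.isLinear.Build _ _ _ _ f f_lin).
pose M := lin1_mx F.
have FM u : T u = u *m M by rewrite mul_rV_lin1.
have [detM|detM] := eqVneq (\det M) 0.
  have /det0P[v v0 vM] : \det M == 0 by rewrite detM.
  by exists v => //; rewrite FM.
case: nbijT; have unitM : M \in unitmx by rewrite unitmxE unitfE.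
exists (fun u : euclidean R 2 => ((u : 'rV_2) *m invmx M) : euclidean R 2) => u.
  by rewrite FM mulmxK.
by rewrite FM mulmxKV.
Qed.

Theorem theorem2p3 (R : realType) (k : nat)
    (T : 'I_k -> {linear euclidean R 2 -> euclidean R 2}) :
  (1 <= k)%N ->
  anti_commuting T ->
  (forall i, contractive (T i)) ->
  (exists j, ~ (T j =1 \0) /\ ~ bijective (T j)) ->
  exists (K : hilbertType R) (U : 'I_k -> {linear K -> K})
         (q : 'I_k -> 'I_k -> R[i]),
    [/\ pm1_valued q, q_commuting q U, (forall i, unitary (U i))
      & dilates U T].
Proof.
move=> _ antiT cT [j [Tj0 /kernel_of_not_bijective[x x0 Tjx0]]].
apply: dilation_of_singular antiT cT Tj0 x0 Tjx0.
exact: orthonormal_basis2_exists.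
Qed.
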